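(* In the optimal stopping setting fixed in the context, let $x_0\in\mathcal I$ be such that $\mu(\{x_0\})>0$. Then $[0,T)\times\{x_0\}\subset\mathcal C$.
   Context: Setting. $(\Omega,\mathcal F,\mathsf P)$ is a complete probability space with a Brownian motion $B$ and its filtration $\mathbb F=(\mathcal F_t)_{t\ge0}$ augmented with $\mathsf P$-null sets. $\mathcal I=(\underline x,\overline x)\subseteq\mathbb R$ is an open (possibly unbounded) interval and $\sigma:\mathcal I\to(0,\infty)$ is continuous. For each $x\in\mathcal I$ the SDE $\mathrm dX_t=\sigma(X_t)\,\mathrm dB_t$, $X_0=x$, has a unique strong solution $X=X^x$ in $\mathcal I$; $X$ is a Feller (hence strong Markov) process and the endpoints $\underline x,\overline x$ are natural boundaries (not reached in finite time; the process cannot be started from them). $\mathsf P_x,\mathsf E_x$ denote probability and expectation given $X_0=x$. $T\in(0,\infty)$; $r:\mathcal I\to[0,\infty)$ and $g:\mathcal I\to\mathbb R$ are continuous; $g$ is a difference of two convex functions; and for every compact $K\subset\mathcal I$, $\sup_{x\in K}\mathsf E_x\big[\sup_{0\le t\le T}e^{-\int_0^t r(X_s)\mathrm ds}|g(X_t)|\big]<\infty$. The value function is $$v(t,x)=\sup_{0\le\tau\le T-t}\mathsf E_x\Big[e^{-\int_0^\tau r(X_s)\mathrm ds}g(X_\tau)\Big],\quad(t,x)\in[0,T]\times\mathcal I,$$ the supremum being over $\mathbb F$-stopping times. The continuation set is $\mathcal C=\{(t,x)\in[0,T]\times\mathcal I: v(t,x)>g(x)\}$. $g'$ is the left derivative of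 $g$, and $g''$ is the signed measure on $\mathcal I$ with $g''([a,b))=g'(b)-g'(a)$. $L^z$ is the local time of $X$ at $z\in\mathcal I$: $L^z_t=\lim_{\varepsilon\to0}\frac1{2\varepsilon}\int_0^t\mathbf 1_{\{X_s\in(z-\varepsilon,z+\varepsilon)\}}\sigma^2(X_s)\mathrm ds$. Set $\ell^z_t=\int_0^te^{-\int_0^sr(X_u)\mathrm du}\mathrm dL^z_s$ and $\mu(\mathrm dz)=g''(\mathrm dz)-2\sigma^{-2}(z)r(z)g(z)\mathrm dz$, with positive and negative parts (Jordan decomposition) $\mu=\mu^+-\mu^-$. It is assumed that for every $x\in\mathcal I$ at least one of $\mathsf E_x[\int_{\mathcal I}\ell^z_T\mu^+(\mathrm dz)]$ and $\mathsf E_x[\int_{\mathcal I}\ell^z_T\mu^-(\mathrm dz)]$ is finite. *)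

(* Defs.v *)
From HB Require Import structures.
From mathcomp Require Export all_boot all_order all_algebra.
From mathcomp Require Export all_classical all_reals all_analysis.

Set Implicit Arguments.
Unset Strict Implicit.
Unset Printing Implicit Defensive.

Import Order.TTheory GRing.Theory Num.Theory.
Import numFieldNormedType.Exports.

Local Open Scope classical_set_scope.
Local Open Scope ring_scope.

(* Processes are functions [R -> Omega -> R]; their values at negative times
   are irrelevant.  As usual, a continuous process is one all of whose sample
   paths are continuous on [0, +oo[. *)
Section brownian_motion.
Context d (Omega : measurableType d) (R : realType) (P : probability Omega R).

Definition natural_events (B : R -> Omega -> R) (t : R) : set (set Omega) :=
  [set A | exists u, exists C : set (measurableTypeR R),
     [/\ 0 <= u <= t, measurable C & A = B u @^-1` C]].

Definition augmented_filtration (B : R -> Omega -> R) (t : R) :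
    set (set Omega) :=
  <<s natural_events B t `|` P.-negligible >>.

Definition continuous_paths (Y : R -> Omega -> R) :=
  forall w, {within `[0, +oo[%classic, continuous (Y ^~ w)}.

Record brownian_motion (B : R -> Omega -> R) : Prop := {
  bm_measurable : forall t : R, 0 <= t -> measurable_fun [set: Omega] (B t);
  bm_continuous : continuous_paths B;
  bm_start : {ae P, forall w, B 0 w = 0};
  bm_gaussian : forall (s t : R) (C : set (measurableTypeR R)),
    0 <= s < t -> measurable C ->
    P [set w | C (B t w - B s w)] = normal_prob 0 (Num.sqrt (t - s)) C;
  bm_independent : forall (s t : R) (A : set Omega) (C : set (measurableTypeR R)),
    0 <= s < t -> <<s natural_events B s >> A -> measurable C ->
    P (A `&` [set w | C (B t w - B s w)]) =
      (P A * P [set w | C (B t w - B s w)%R])%E }.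

End brownian_motion.

Section stochastic_integral.
Context d (Omega : measurableType d) (R : realType) (P : probability Omega R).
Variables (F : R -> set (set Omega)) (B : R -> Omega -> R).

Definition adapted (Y : R -> Omega -> R) :=
  forall t (C : set (measurableTypeR R)),
    0 <= t -> measurable C -> F t (Y t @^-1` C).

Definition stopping_time (tau : Omega -> R) :=
  (forall w, 0 <= tau w) /\ forall t, 0 <= t -> F t [set w | tau w <= t].

(* The simple process sum_(k < n) xi_k 1_(]t_k, t_(k+1)]). *)
Record simple_process := SimpleProcess {
  sp_size : nat;
  sp_time : nat -> R;
  sp_coef : nat -> Omega -> R }.

Definition is_simple (H : simple_process) :=
  [/\ 0 <= sp_time H 0, {homo sp_time H : i j / (i <= j)%N >-> i <= j} &
    forall k, (k < sp_size H)%N ->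
      (exists M, forall w, `|sp_coef H k w| <= M) /\
      (forall C : set (measurableTypeR R), measurable C ->
        F (sp_time H k) (sp_coef H k @^-1` C))].

Definition sp_value (H : simple_process) (t : R) (w : Omega) : R :=
  \sum_(k < sp_size H)
    sp_coef H k w * \1_(`]sp_time H k, sp_time H k.+1]%classic) t.

Definition sp_integral (H : simple_process) (t : R) (w : Omega) : R :=
  \sum_(k < sp_size H) sp_coef H k w *
    (B (Num.min (sp_time H k.+1) t) w - B (Num.min (sp_time H k) t) w).

(* Y_t = int_0^t H_s dB_s: Y is the limit, uniformly on compact time intervals
   in probability, of the integrals of simple processes that approximate H in
   L^2([0, t]) in probability for every t. *)
Definition ito_integral (H Y : R -> Omega -> R) :=
  exists Hn : nat -> simple_process,
    (forall n, is_simple (Hn n)) /\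
    forall t e : R, 0 <= t -> 0 < e ->
      (P [set w | (e%:E < \int[lebesgue_measure]_(s in `[0%R, t])
                      ((sp_value (Hn n) s w - H s w) ^+ 2)%:E)%E]
         @[n --> \oo] --> 0%E) /\
      (P [set w | exists2 s, 0 <= s <= t &
                    e < `|sp_integral (Hn n) s w - Y s w|]
         @[n --> \oo] --> 0%E).

End stochastic_integral.

Section diffusion.
Context d (Omega : measurableType d) (R : realType) (P : probability Omega R).

Definition open_interval (xl xr : \bar R) : set R :=
  [set x | (xl < x%:E < xr)%E].

(* dY_t = sigma(Y_t) dB_t, Y_0 = x, in the state space I. *)
Record sde_solution (I : set R) (sigma : R -> R) (B : R -> Omega -> R)
    (x : R) (Y : R -> Omega -> R) : Prop := {
  sol_state : forall t w, 0 <= t -> I (Y t w);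
  sol_continuous : continuous_paths Y;
  sol_adapted : adapted (augmented_filtration P B) Y;
  sol_start : {ae P, forall w, Y 0 w = x};
  sol_equation : ito_integral P (augmented_filtration P B) B
    (fun t w => sigma (Y t w)) (fun t w => Y t w - x) }.

Definition unique_strong_solution (I : set R) (sigma : R -> R)
    (B : R -> Omega -> R) (x : R) (Y : R -> Omega -> R) :=
  sde_solution I sigma B x Y /\
  forall Z, sde_solution I sigma B x Z ->
    {ae P, forall w, forall t, 0 <= t -> Z t w = Y t w}.

(* Continuous functions on I vanishing at its endpoints. *)
Definition C0 (I : set R) (f : R -> R) :=
  {within I, continuous f} /\
  forall e, 0 < e -> exists K, [/\ compact K, K `<=` I &
    forall x, I x -> ~ K x -> `|f x| < e].

Definition transition (X : R -> R -> Omega -> R) (t : R) (f : R -> R)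
    (x : R) : R := fine 'E_P[fun w => f (X x t w)]%E.

Definition feller_process (I : set R) (F : R -> set (set Omega))
    (X : R -> R -> Omega -> R) :=
  [/\ forall f t, C0 I f -> 0 <= t -> C0 I (transition X t f),
      forall f x, C0 I f -> I x ->
        transition X t f x @[t --> 0^'+] --> f x &
      forall f x (s t : R) A, C0 I f -> I x -> 0 <= s -> 0 <= t -> F s A ->
        'E_P[fun w => (\1_A w * f (X x (s + t) w))%R]%E =
        'E_P[fun w => (\1_A w * transition X t f (X x s w))%R]%E ].

(* The endpoints are not reached since X lives in I (see [sde_solution]); being
   natural, they are moreover not entrance points: for z in I and t > 0, the
   probability P_y(X hits z before time t) tends to 0 as y tends to either
   endpoint. *)
Definition natural_boundaries (I : set R) (X : R -> R -> Omega -> R) :=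
  forall z t e, I z -> 0 < t -> 0 < e ->
    exists c c', [/\ I c, I c' & forall y, I y -> y < c \/ c' < y ->
      (P [set w | exists2 s, (0 <= s < t)%R & X y s w = z] <= e%:E)%E].

Definition discount (r : R -> R) (Y : R -> Omega -> R) (t : R) (w : Omega) :
    R :=
  expR (- \int[lebesgue_measure]_(s in `[0, t]) r (Y s w)).

Definition local_time (sigma : R -> R) (Y : R -> Omega -> R) (z t : R)
    (w : Omega) : R :=
  lim ((2 * e)^-1 * (\int[lebesgue_measure]_(s in `[0, t])
    (\1_(`]z - e, z + e[%classic) (Y s w) * sigma (Y s w) ^+ 2))
    @[e --> 0^'+]).

End diffusion.

Section stieltjes.
Context (R : realType).

(* G itself when it is nondecreasing and right-continuous. *)
Definition cumulative_of (G : R -> R) : cumulative R R :=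
  match pselect (exists H : cumulative R R, H =1 G) with
  | left exH => projT1 (cid exH)
  | right _ => (idfun : cumulative R R)
  end.

Definition stieltjes (G : R -> R) := lebesgue_stieltjes_measure (cumulative_of G).

End stieltjes.

Section discounted_local_time.
Context d (Omega : measurableType d) (R : realType).

(* The local time is extended by L_0 = 0 to negative times, so as to be a
   function on the whole line. *)
Definition discounted_local_time (sigma r : R -> R) (Y : R -> Omega -> R)
    (z t : R) (w : Omega) : \bar R :=
  let L (s : R) := local_time sigma Y z (Num.max s 0) w in
  (\int[stieltjes L]_(s in `]0%R, t]) (discount r Y s w)%:E)%E.

End discounted_local_time.

Section signed_measures.
Context (R : realType).

Definition difference_of_convex (I : set R) (g : R -> R) :=
  exists g1 g2 : R -> R,
    [/\ convex_function (I : set R^o) (g1 : R^o -> R^o),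
        convex_function (I : set R^o) (g2 : R^o -> R^o) &
        forall x, I x -> g x = g1 x - g2 x].

Definition left_derivative (g : R -> R) (x : R) : R :=
  lim (h^-1 * (g (x + h) - g x) @[h --> 0^'-]).

(* A signed measure on an interval I may have infinite positive and negative
   total masses: it is a real-valued function of the Borel sets contained in
   compact subintervals of I, countably additive within each of them. *)
Definition signed_measure_on (I : set R) (nu : set R -> R) :=
  forall a b, I a -> I b ->
    exists c : {charge set (measurableTypeR R) -> \bar R},
      forall A : set (measurableTypeR R), measurable A ->
        A `<=` `[a, b]%classic -> c A = (nu A)%:E.

Definition second_derivative_measure (I : set R) (g : R -> R)
    (ddg : set R -> R) :=
  signed_measure_on I ddg /\
  forall a b, I a -> I b -> a < b ->
    ddg `[a, b[%classic = left_derivative g b - left_derivative g a.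

Definition mu_measure (sigma r g : R -> R) (ddg : set R -> R) (A : set R) : R :=
  ddg A - \int[lebesgue_measure]_(z in A) (2 * (sigma z) ^- 2 * r z * g z).

(* nu = nup - num on I, with nup and num concentrated on disjoint sets. *)
Definition jordan_decomposition_on (I : set R) (nu : set R -> R)
    (nup num : {measure set (measurableTypeR R) -> \bar R}) :=
  (exists D : set (measurableTypeR R),
     [/\ measurable D, nup (I `\` D) = 0%E & num (I `&` D) = 0%E]) /\
  forall a b (A : set (measurableTypeR R)), I a -> I b ->
    measurable A -> A `<=` `[a, b]%classic ->
    [/\ nup A \is a fin_num, num A \is a fin_num &
        (nu A)%:E = (nup A - num A)%E].

End signed_measures.

Section optimal_stopping.
Context d (Omega : measurableType d) (R : realType) (P : probability Omega R).

Definition integrable_reward (I : set R) (T : R) (r g : R -> R)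
    (X : R -> R -> Omega -> R) :=
  forall K, compact K -> K `<=` I ->
    (ereal_sup [set \int[P]_w
       ereal_sup [set (discount r (X x) t w * `|g (X x t w)|)%:E
                 | t in `[0%R, T]] | x in K] < +oo)%E.

Definition value (F : R -> set (set Omega)) (T : R) (r g : R -> R)
    (X : R -> R -> Omega -> R) (t x : R) : \bar R :=
  ereal_sup [set 'E_P[fun w => (discount r (X x) (tau w) w *
                               g (X x (tau w) w))%R]%E
            | tau in [set tau | stopping_time F tau /\
                                forall w, tau w <= T - t]].

Definition continuation_set (I : set R) (F : R -> set (set Omega)) (T : R)
    (r g : R -> R) (X : R -> R -> Omega -> R) : set (R * R) :=
  [set tx | [/\ 0 <= tx.1 <= T, I tx.2 &
    ((g tx.2)%:E < value F T r g X tx.1 tx.2)%E]].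

Definition expected_local_time (I : set R) (T : R) (sigma r : R -> R)
    (Y : R -> Omega -> R)
    (nu : {measure set (measurableTypeR R) -> \bar R}) : \bar R :=
  (\int[P]_w \int[nu]_(z in I) discounted_local_time sigma r Y z T w)%E.

End optimal_stopping.

(* Main.v *)
Require Import Defs.
From mathcomp Require Import measurable_realfun ring lra.

Import Order.TTheory GRing.Theory Num.Theory.
Import numFieldNormedType.Exports.

Local Open Scope classical_set_scope.
Local Open Scope ring_scope.

Set Implicit Arguments.
Unset Strict Implicit.
Unset Printing Implicit Defensive.

(** Why it is worth waiting at a convex kink.

    An atom of mu at x0 is an upward jump of the derivative of g, so that near
    x0 the reward dominates a wedge g x0 + a (y - x0) + k |y - x0| with k > 0
    ([kink_lower_bound]).  Start the diffusion X at x0 and stop it at tau, the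
    time at which it leaves ]x0 - dl, x0 + dl[, capped at the remaining horizon
    h = T - t > 0.  If sigma^2 >= m > 0 near x0, then the displacement
    W = X_tau - x0 satisfies

      |W| <= dl,   E W = 0,   E W^2 >= (m / 16) E tau        ([exit_moments]).

    Since |W| >= W^2 / dl, the wedge pays at least (k / dl) (m / 16) E tau more
    than g x0 on average, while discounting over a time tau costs at most a
    constant times E tau, with a constant that does not grow as dl shrinks.
    As E tau > 0, the gain prevails once dl is small ([exit_reward_gt]): a
    quadratic gain at scale dl carries a factor 1 / dl, which beats every effect
    of order E tau.

    The moments of W are the stochastic part.  The increments of X are a limit
    in probability of integrals of simple processes, so neither the martingale
    property nor the isometry is available for them directly.  On a fine grid
    that contains the jump times of a simple process, its integral is a sum of
    terms xi_j (B_(c_(j+1)) - B_(c_j)).  This sum is frozen once tau has passed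
    or once it has left ]- 2 dl, 2 dl[.  Independence of the increments from
    the augmented filtration gives it mean zero ([stopped_sum_mean]) and an
    isometry inequality ([stopped_sum_second_moment]).  It may overshoot
    the level of freezing, but the overshoot is controlled by the fourth powers
    of the increments, whose expected sum is of the order of the mesh
    ([stopped_sum_overshoot], [increments_fourth_moment]).  Path by path,
    outside an event of small probability, the frozen sum is close to W and its
    bracket is almost (m / 2) tau ([stopped_sum_approx]); the bound on the
    overshoot makes the small event negligible in the limit
    ([approximable_moments]).

    Lower bounds for E W^2 suffice, up to a constant factor.  Hence only crude
    moments of the normal law are needed: a lower bound on the variance and an
    upper bound on the fourth moment. *)

(** * Lower bound of the reward near a convex kink *)

Section kink.
Context (R : realType).
Implicit Types (I : set R) (f g : R -> R).

Lemma convex_chord I f a b c : convex_function (I : set R^o) (f : R^o -> R^o) ->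
  I a -> I c -> a < b -> b < c -> (c - a) * f b <= (c - b) * f a + (b - a) * f c.
Proof.
move=> cf Ia Ic ab bc.
have ac : 0 < c - a by lra.
pose t := (c - b) / (c - a).
have t0 : 0 <= t by apply: divr_ge0; lra.
have t1 : t <= 1 by rewrite ler_pdivrMr //; lra.
have tE : t * (c - a) = c - b by rewrite divfK // gt_eqF.
have t01 : (Itv.spec (@Itv.num_sem R) (Itv.Real `[0%Z, 1%Z]) t).
  by apply/and3P; split; rewrite ?num_real // ?bnd_simp.
have H : f (t * a + (1 - t) * c) <= t * f a + (1 - t) * f c.
  by apply: (cf (Itv.Def t01) a c); rewrite inE.
have E : t * a + (1 - t) * c = b.
  have -> : t * a + (1 - t) * c = c - t * (c - a) by ring.
  by rewrite tE; ring.
rewrite E in H.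
have := ler_wpM2l (ltW ac) H.
have -> : (c - a) * (t * f a + (1 - t) * f c) =
  t * (c - a) * f a + (c - a - t * (c - a)) * f c by ring.
by rewrite tE; nra.
Qed.

(** The difference quotients of a convex function increase, so they have a limit
    from the left as soon as the point is interior. *)
Lemma convex_left_difference_quotient_cvg I f x (d : R) : 0 < d ->
  convex_function (I : set R^o) (f : R^o -> R^o) ->
  (forall y, `|y - x| <= d -> I y) ->
  cvg (h^-1 * (f (x + h) - f x) @[h --> 0^'-]).
Proof.
move=> d0 cf Id.
have Iin y : x - d <= y <= x + d -> I y.
  by move=> ?; apply: Id; rewrite ler_norml; lra.
apply: nondecreasing_at_left_is_cvgr.
- near=> z => h k; rewrite !in_itv /= => /andP[zh h0] /andP[zk k0].
  rewrite le_eqVlt => /predU1P[->//|hk].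
  have dz : - d < z by near: z; apply: nbhs_left_gt; lra.
  have xhk : x + h < x + k by rewrite ltrD2l.
  have xk0 : x + k < x by rewrite gtrDl.
  have H := convex_chord cf (Iin (x + h) _) (Iin x _) xhk xk0.
  have {}H := H ltac:(lra) ltac:(lra).
  have hk0 : 0 < h * k by nra.
  rewrite -(ler_pM2l hk0).
  rewrite !mulrA mulfK ?lt_eqF // (mulrC h k) mulfK ?lt_eqF //.
  by nra.
- near=> z; exists (d^-1 * (f (x + d) - f x)) => _ [h /= + <-].
  rewrite in_itv /= => /andP[zh h0].
  have dz : - d < z by near: z; apply: nbhs_left_gt; lra.
  have xh : x + h < x by rewrite gtrDl.
  have xd : x < x + d by rewrite ltrDl.
  have H := convex_chord cf (Iin (x + h) _) (Iin (x + d) _) xh xd.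
  have {}H := H ltac:(lra) ltac:(lra).
  have hd : 0 < (- h) * d by nra.
  rewrite -(ler_pM2l hd).
  have -> : - h * d * (h^-1 * (f (x + h) - f x)) = - d * (f (x + h) - f x) * (h / h)
    by ring.
  have -> : - h * d * (d^-1 * (f (x + d) - f x)) = - h * (f (x + d) - f x) * (d / d)
    by ring.
  have -> : h / h = 1 by rewrite divff // lt_eqF.
  have -> : d / d = 1 by rewrite divff // gt_eqF.
  by rewrite !mulr1; nra.
Unshelve. all: end_near. Qed.

(** For a difference of convex functions the left derivative is a genuine limit,
    not a default value. *)
Lemma left_derivative_cvg I g x (d : R) : 0 < d -> difference_of_convex I g ->
  (forall y, `|y - x| <= d -> I y) ->
  h^-1 * (g (x + h) - g x) @[h --> 0^'-] --> left_derivative g x.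
Proof.
move=> d0 [g1 [g2 [c1 c2 gE]]] Id.
have C1 := convex_left_difference_quotient_cvg d0 c1 Id.
have C2 := convex_left_difference_quotient_cvg d0 c2 Id.
apply/cvg_ex; eexists; apply: cvg_trans; last exact: (cvgB C1 C2).
apply: near_eq_cvg; near=> h.
have hd : - d < h by near: h; apply: nbhs_left_gt; lra.
have h0 : h < 0 by near: h; exact: nbhs_left_lt.
rewrite !gE.
- by rewrite !fctE -mulrBr; congr (_ * _); ring.

- by apply: Id; rewrite subrr normr0 ltW.
- by apply: Id; rewrite (addrC x) addrK ler_norml; lra.
Unshelve. all: end_near. Qed.

(** After subtraction of a linear function, every point beyond the left end has
    smaller values just before it; hence the minimum is at the left end. *)
Lemma increment_ge_left_derivative f (a b m : R) (f' : R -> R) : a <= b ->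
  {within `[a, b], continuous f} ->
  (forall y, a < y <= b ->
    h^-1 * (f (y + h) - f y) @[h --> 0^'-] --> f' y /\ m < f' y) ->
  m * (b - a) <= f b - f a.
Proof.
move=> ab cf df.
have cphi : {within `[a, b], continuous (fun x => f x - m * x)}.
  move=> x; apply: cvgB; first exact: cf.
  apply: cvgM; first exact: cvg_cst.
  have cid : {within `[a, b], continuous (fun z : R => z)}.
    by apply: continuous_subspaceT => z; exact: cvg_id.
  exact: cid.
have [c] := EVT_min ab cphi.
rewrite in_itv /= => /andP[ac cb] cmin.
have [ca|ca] := eqVneq c a.
  have := cmin b; rewrite in_itv /= lexx ab /= ca => /(_ isT); nra.
have {}ac : a < c by rewrite lt_neqAle eq_sym ca.
have [|dfc mf] := df c; first by rewrite ac.
have: \forall h \near 0^'-, m < h^-1 * (f (c + h) - f c) by exact: cvgr_gt dfc _ mf.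
move=> H; exfalso.
have : \forall h \near (0:R)^'-, False.
  near=> h.
  have h0 : h < 0 by near: h; exact: nbhs_left_lt.
  have ha : a - c < h by near: h; apply: nbhs_left_gt; lra.
  have : m < h^-1 * (f (c + h) - f c) by near: h.
  rewrite mulrC ltr_ndivlMr // => H1.
  have := cmin (c + h) ltac:(rewrite in_itv /=; lra).
  nra.
by move/filter_ex => -[].
Unshelve. all: end_near. Qed.

Lemma cvge_ltr T (F : set_system T) (u : T -> \bar R) (l : \bar R) (e : R) :
  Filter F -> u @ F --> l -> (l < e%:E)%E -> \forall n \near F, (u n < e%:E)%E.
Proof.
move=> FF ul le; apply: (ul [set y | (y < e%:E)%E]).
by apply: open_nbhs_nbhs; split; [exact: open_ereal_lt_ereal|].
Qed.

(** Only the negative part of nu on ]x, y[ can lower the mass below that of the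
    atom, and it vanishes as y decreases to x. *)
Lemma charge_co_near (nu : {charge set (measurableTypeR R) -> \bar R}) (x e : R) :
  0 < e ->
  \forall y \near x^'+, (nu [set x] - e%:E <= nu `[x, y[%classic)%E.
Proof.
move=> e0.
have [p [n nuPN]] := Hahn_decomposition nu.
have n0 : (jordan_neg nuPN) (`]x, (x + k.+1%:R^-1)[%classic) @[k --> \oo] --> 0%E.
  have -> : 0%E = jordan_neg nuPN (\bigcap_k `]x, (x + k.+1%:R^-1)[%classic).
    rewrite (_ : \bigcap_k _ = set0) ?measure0 //.
    rewrite -subset0 => z /= H.
    have /= := H 0%N I; rewrite in_itv /= => /andP[xz _].
    have [k kz] := ltr_add_invr xz; have := H k I; rewrite /= in_itv /= => /andP[_ ].
    by rewrite ltNge (ltW kz).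
  apply: nonincreasing_cvg_mu => //.
  - by rewrite -ge0_fin_numE // fin_num_measure.
  - exact: bigcapT_measurable.
  - move=> i j ij; apply/subsetPset => z /=; rewrite !in_itv /= => /andP[-> /=].
    move=> /lt_le_trans; apply; rewrite lerD2l lef_pV2 ?posrE // ler_nat.
    by rewrite ltnS.
have /filter_ex[k /= ke] : \forall k \near \oo,
    ((jordan_neg nuPN) (`]x, (x + k.+1%:R^-1)%R[%classic) < e%:E)%E.
  by apply: (cvge_ltr _ n0); rewrite lte_fin.
near=> y.
have xy : x < y by near: y; exact: nbhs_right_gt.
have yk : y < x + k.+1%:R^-1 by near: y; apply: nbhs_right_lt; rewrite ltrDl.
have -> : `[x, y[%classic = [set x] `|` `]x, y[%classic.
  by rewrite setU1itv ?bnd_simp.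
rewrite chargeU //; last first.
  by rewrite -subset0 => z /= [->]; rewrite in_itv /= ltxx.
apply: leeD2l.
rewrite (jordan_decomp nuPN) // /cadd /= /cscale EFinN mulN1e.
apply: (@le_trans _ _ (- jordan_neg nuPN `]x, y[%classic)%E).
  rewrite leeN2; apply: le_trans (ltW ke); apply: le_measure; rewrite ?inE //.
  by move=> z /=; rewrite !in_itv /= => /andP[-> /=] /lt_trans; apply.
by rewrite leeDr.
Unshelve. all: end_near. Qed.

(** With p the left derivative at x0 and D the mass of the atom, the slopes are
    at most p + D/3 just to the left of x0.  To its right the left derivative at
    y is p plus the mass of [x0, y[, hence at least p + 2D/3, and increments
    inherit every smaller slope.  A wedge with slopes in between lies below g. *)
Lemma kink_lower_bound I g (ddg : set R -> R) (x0 d0 : R) : 0 < d0 ->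
  (forall y, `|y - x0| <= d0 -> I y) -> {within I, continuous g} ->
  difference_of_convex I g -> second_derivative_measure I g ddg ->
  0 < ddg [set x0] ->
  exists a k d, [/\ 0 < k, 0 < d <= d0 &
    forall x, `|x - x0| <= d -> g x0 + a * (x - x0) + k * `|x - x0| <= g x].
Proof.
move=> d0_gt0 Id cg dcg [sm ddgE] D_gt0.
set D := ddg [set x0] in D_gt0.
have dg y : `|y - x0| < d0 -> h^-1 * (g (y + h) - g y) @[h --> 0^'-] -->
  left_derivative g y.
  move=> yx; apply: (@left_derivative_cvg I g y (d0 - `|y - x0|)) => //;
    first by rewrite subr_gt0.
  move=> z zy; apply: Id; have -> : z - x0 = (z - y) + (y - x0) by ring.
  by apply: le_trans (ler_normD _ _) _; rewrite -lerBrDr.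
have Ix0 : I x0 by apply: Id; rewrite subrr normr0 ltW.
have Ix0d : I (x0 + d0) by apply: Id; rewrite addrAC subrr add0r gtr0_norm.
pose e := D / 3; have e0 : 0 < e by rewrite divr_gt0.
have De : D = 3 * e by rewrite /e; field.
pose p := left_derivative g x0.
have [nu nuE] := sm _ _ Ix0 Ix0d.
have [d1 /= d1_gt0 Hd1] := charge_co_near nu x0 e0.
have dr y : x0 < y -> y < x0 + d0 -> y < x0 + d1 -> p + 2 * e <= left_derivative g y.
  move=> xy yd yd1.
  have := Hd1 y; rewrite /ball_ /= => /(_ _ xy).
  rewrite distrC gtr0_norm ?subr_gt0 // ltrBlDl => /(_ yd1).
  rewrite !nuE //; last 2 first.
  - move=> z /=; rewrite !in_itv /= => /andP[-> /=] /lt_trans /(_ yd) /ltW; exact.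
  - by move=> z /= ->; rewrite in_itv /= lexx lerDl ltW.
  rewrite ddgE //; last by apply: Id; rewrite gtr0_norm ?subr_gt0 // lerBlDl ltW.
  by rewrite -EFinB lee_fin -/D -/p De; lra.
have : \forall h \near (0:R)^'-, h^-1 * (g (x0 + h) - g x0) < p + e.
  apply: cvgr_lt (dg x0 _) _ _; first by rewrite subrr normr0.
  by rewrite ltrDl.
case=> d2 /= d2_gt0 Hd2.
pose d := Num.min (d0 / 2) (Num.min (d1 / 2) (d2 / 2)).
have dP : [/\ 0 < d, d < d0, d < d1 & d < d2].
  rewrite /d; split.
  - by rewrite !lt_min !divr_gt0.
  - by rewrite gt_min; apply/orP; left; lra.
  - by rewrite !gt_min; apply/orP; right; apply/orP; left; lra.
  - by rewrite !gt_min; apply/orP; right; apply/orP; right; lra.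
case: dP => d_gt0 dd0 dd1 dd2.
exists (p + 5 / 4 * e), (e / 4), d; split; [lra|by rewrite d_gt0 ltW|].
move=> x; have [xx0|xx0|->] := ltgtP x x0; last by rewrite subrr normr0 !mulr0 !addr0.
- have xx : 0 > x - x0 by rewrite subr_lt0.
  rewrite ltr0_norm // => xd.
  have xd2 : - (x - x0) < d2 by lra.
  have := Hd2 (x - x0); rewrite /ball_ /= sub0r normrN ltr0_norm // => /(_ xd2 xx).
  rewrite (_ : x0 + (x - x0) = x); last by ring.
  by rewrite mulrC ltr_ndivrMr // => H; nra.
- have xx : 0 < x - x0 by rewrite subr_gt0.
  rewrite gtr0_norm // => xd.
  have : (p + 2 * e - e / 2) * (x - x0) <= g x - g x0; last by nra.
  apply: (increment_ge_left_derivative (f' := left_derivative g)); first exact: ltW.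
    apply: continuous_subspaceW cg => z /=; rewrite in_itv /= => /andP[z1 z2].
    by apply: Id; rewrite ger0_norm; lra.
  move=> y /andP[y1 y2]; split; first by apply: dg; rewrite gtr0_norm; lra.
  have := dr y; lra.
Qed.
End kink.

(** * Moments of centred normal laws *)

Section gaussian_moments.
Context (R : realType).
Notation leb := (@lebesgue_measure R).

(** The density of the normal law is its Radon-Nikodym derivative. *)
Lemma ge0_integral_normal_prob (m s : R) (f : _ -> \bar R) :
  measurable_fun setT f -> (forall x, 0 <= f x)%E ->
  (\int[normal_prob m s]_x f x =
   \int[leb]_x (f x * (normal_pdf m s x)%:E))%E.
Proof.
move=> mf f0.
have dom := normal_prob_dominates m s.
rewrite -(Radon_Nikodym_SigmaFinite.change_of_variables dom) //.
apply: ae_eq_integral => //.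
- apply: emeasurable_funM => //.
  apply: (@measurable_int _ _ _ leb).
  exact: Radon_Nikodym_SigmaFinite.f_integrable.
- apply: emeasurable_funM => //.
  by apply/measurable_EFinP; exact: measurable_normal_pdf.
apply: ae_eqe_mul2l.
apply: integral_ae_eq => //.
- exact: Radon_Nikodym_SigmaFinite.f_integrable.
- by apply/measurable_EFinP; exact: measurable_normal_pdf.
- by move=> E _ mE; rewrite -Radon_Nikodym_SigmaFinite.f_integral.
Qed.

(** The weight x^4 costs a factor s^4 and a doubling of the variance, because
    t^2 <= 4 exp t at t = x^2/(4 s^2). *)
Lemma fourth_moment_normal_prob (s : R) : 0 < s ->
  (\int[normal_prob 0 s]_x (x ^+ 4)%:E <= (128 * s ^+ 4)%:E)%E.
Proof.
move=> s0; have sn0 : s != 0 by rewrite gt_eqF.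
have mx4 : measurable_fun [set: R] (fun x : R => (x ^+ 4)%:E).
  by apply/measurable_EFinP; exact: measurable_funX.
have x4ge0 (x : R) : 0 <= x ^+ 4 by rewrite exprn_even_ge0.
rewrite ge0_integral_normal_prob //.
pose q := Num.sqrt 2 * s.
have q0 : 0 < q by rewrite mulr_gt0 ?sqrtr_gt0.
have qn0 : q != 0 by rewrite gt_eqF.
have q2 : q ^+ 2 = 2 * s ^+ 2 by rewrite exprMn sqr_sqrtr.
have bound x : x ^+ 4 * normal_pdf 0 s x <= 128 * s ^+ 4 * normal_pdf 0 q x.
  rewrite !normal_pdfE //.
  have -> : normal_peak s = Num.sqrt 2 * normal_peak q.
    rewrite /normal_peak q2.
    have -> : 2 * s ^+ 2 * pi *+ 2 = 2 * (s ^+ 2 * pi *+ 2) by rewrite mulrnAr !mulrA.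
    by rewrite [in RHS]sqrtrM // invfM mulrA divff ?mul1r // gt_eqF // sqrtr_gt0.
  set t := (x / (2 * s)) ^+ 2.
  have nq : normal_fun 0 q x = expR (- t).
    rewrite /normal_fun subr0 q2 /t; congr expR.
    by rewrite -[_ *+ 2]mulr_natl; field.
  have ns : normal_fun 0 s x = expR (- t) * expR (- t).
    rewrite /normal_fun subr0 /t -expRD; congr expR.
    by rewrite -[_ *+ 2]mulr_natl; field.
  have x4 : x ^+ 4 = 16 * s ^+ 4 * t ^+ 2 by rewrite /t; field.
  rewrite nq ns x4.
  have t0 : 0 <= t by exact: sqr_ge0.
  have et : t ^+ 2 * expR (- t) <= 4.
    rewrite expRN ler_pdivrMr ?expR_gt0 //.
    have := expR_ge1Dx (t / 2).
    have -> : expR t = expR (t / 2) ^+ 2 by rewrite expr2 -expRD; congr expR; field.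
    by move=> h; nra.
  have s2 : Num.sqrt 2 <= 2 :> R.
    by rewrite -(@ler_pXn2r _ 2) ?nnegrE ?sqrtr_ge0 // sqr_sqrtr // expr2; lra.
  have -> : 16 * s ^+ 4 * t ^+ 2 * (Num.sqrt 2 * normal_peak q * (expR (- t) * expR
    (- t))) =
    16 * s ^+ 4 * (normal_peak q * expR (- t)) * (Num.sqrt 2 * (t ^+ 2 * expR (- t)))
      by ring.
  have -> : 128 * s ^+ 4 * (normal_peak q * expR (- t)) = 16 * s ^+ 4 * (normal_peak
    q * expR (- t)) * 8 by ring.
  apply: ler_wpM2l; first
    by rewrite !mulr_ge0 ?normal_peak_ge0 ?expR_ge0 // ?exprn_ge0 // ltW.
  have t2e : 0 <= t ^+ 2 * expR (- t) by rewrite mulr_ge0 ?expR_ge0 ?sqr_ge0.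
  have := @sqrtr_ge0 _ (2 : R); nra.
apply: (@le_trans _ _ (\int[leb]_x ((128 * s ^+ 4)%:E * (normal_pdf 0 q x)%:E))%E).
  apply: ge0_le_integral => //.
  - by move=> x _; rewrite -EFinM lee_fin mulr_ge0 ?normal_pdf_ge0.
  - by apply: emeasurable_funM => //; apply/measurable_EFinP;
    exact: measurable_normal_pdf.
  - by apply: emeasurable_funM => //; apply/measurable_EFinP;
    exact: measurable_normal_pdf.
  - by move=> x _; rewrite -!EFinM lee_fin bound.
have s4 : 0 <= 128 * s ^+ 4 by rewrite mulr_ge0.
rewrite ge0_integralZl ?lee_fin //.
- by rewrite integral_normal_pdf mule1.
- by apply/measurable_EFinP; exact: measurable_normal_pdf.
- by move=> x _; rewrite lee_fin normal_pdf_ge0.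
Qed.

Lemma integrable_normal_prob_pow4 (s : R) : 0 < s ->
  (normal_prob 0 s).-integrable setT (fun x : measurableTypeR R => (x ^+ 4)%:E).
Proof.
move=> s0; apply/integrableP; split.
  by apply/measurable_EFinP; exact: measurable_funX.
under eq_integral do rewrite gee0_abs ?lee_fin ?exprn_even_ge0 //.
exact: le_lt_trans (fourth_moment_normal_prob s0) (ltry _).
Qed.

Lemma integrable_normal_prob_pow2 (s : R) : 0 < s ->
  (normal_prob 0 s).-integrable setT (fun x : measurableTypeR R => (x ^+ 2)%:E).
Proof.
move=> s0; apply: (le_integrable measurableT (g :=
  fun x : measurableTypeR R => 1%:E + (x ^+ 4)%:E)%E) => //.
- by apply/measurable_EFinP; exact: measurable_funX.
- move=> x _; rewrite -EFinD !abse_EFin lee_fin !ger0_norm ?addr_ge0 ?exprn_even_ge0 //.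
  by have := sqr_ge0 (x ^+ 2 - 1); have := sqr_ge0 (x ^+ 2); nra.
- apply: integrableD => //; last exact: integrable_normal_prob_pow4.
  exact: finite_measure_integrable_cst.
Qed.

Lemma integrable_normal_prob_id (s : R) : 0 < s ->
  (normal_prob 0 s).-integrable setT (fun x : measurableTypeR R => x%:E).
Proof.
move=> s0; apply: (le_integrable measurableT (g :=
  fun x : measurableTypeR R => 1%:E + (x ^+ 2)%:E)%E) => //.
- by apply/measurable_EFinP; exact: measurable_id.
- move=> x _; rewrite -EFinD !abse_EFin lee_fin [leRHS]ger0_norm ?addr_ge0
  ?exprn_even_ge0 //.
  by rewrite ler_norml; have := sqr_ge0 (x - 1); have := sqr_ge0 (x + 1); nra.
- apply: integrableD => //; last exact: integrable_normal_prob_pow2.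
  exact: finite_measure_integrable_cst.
Qed.

(** At most half of the mass lies within s/2 of the mean, since the density is
    at most 1/(s sqrt(2 pi)) and 2 pi >= 4. *)
Lemma second_moment_normal_prob_ge (s : R) : 0 < s ->
  ((s ^+ 2 / 8)%:E <= \int[normal_prob 0 s]_x (x ^+ 2)%:E)%E.
Proof.
move=> s0.
pose J : set (measurableTypeR R) := `[- (s / 2), s / 2]%classic.
have mJ : measurable J by exact: measurable_itv.
have NJ : (normal_prob 0 s J <= (2^-1)%:E)%E.
  rewrite /normal_prob.
  apply: (@le_trans _ _ (\int[leb]_(x in J) (normal_peak s)%:E)%E).
    apply: ge0_le_integral => //.
    - by move=> x _; rewrite lee_fin normal_pdf_ge0.
    - by apply/measurable_EFinP/measurable_funTS; exact: measurable_normal_pdf.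
    - by move=> x _; rewrite lee_fin normal_pdf_ub // gt_eqF.
  have lJ : leb J = s%:E.
    rewrite /J lebesgue_measure_itv /= lte_fin ifT; last by lra.
    by rewrite -EFinB opprK -splitr.
  rewrite integral_cst // [X in (_ * X)%E]lJ -EFinM lee_fin.
  rewrite /normal_peak mulrC ler_pdivrMr ?sqrtr_gt0; last first.
    by rewrite mulrn_wgt0 // mulr_gt0 ?pi_gt0 // exprn_gt0.
  rewrite -ler_pdivrMl // invrK.
  rewrite -(@ler_pXn2r _ 2) ?nnegrE ?sqrtr_ge0 //; last by rewrite mulr_ge0 // ltW.
  rewrite sqr_sqrtr; last by rewrite mulrn_wge0 // mulr_ge0 ?sqr_ge0 // ltW // pi_gt0.
  have pi2 := pi_ge2 R; rewrite -[leRHS]mulr_natl.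
  have : 0 <= s ^+ 2 * (pi - 2) by rewrite mulr_ge0 ?sqr_ge0 // subr_ge0.
  by nra.
have NJC : ((2^-1)%:E <= normal_prob 0 s (~` J))%E.
  rewrite probability_setC // leeBrDr ?fin_num_measure //.
  apply: (@le_trans _ _ ((2^-1)%:E + (2^-1)%:E)%E); first exact: leeD2l.
  by rewrite -EFinD lee_fin; lra.
apply: (@le_trans _ _ (\int[normal_prob 0 s]_(x in ~` J) (s ^+ 2 / 4)%:E)%E).
  rewrite integral_cst //; last exact: measurableC.
  apply: le_trans (lee_wpmul2l _ NJC).
    by rewrite -EFinM lee_fin; lra.
  by rewrite lee_fin divr_ge0 ?sqr_ge0.
apply: (@le_trans _ _ (\int[normal_prob 0 s]_(x in ~` J) (x ^+ 2)%:E)%E).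
  apply: ge0_le_integral => //; first exact: measurableC.
  - by move=> x _; rewrite lee_fin divr_ge0 ?sqr_ge0.
  - by apply/measurable_EFinP; apply: measurable_funX.
  - move=> x; rewrite /J /= in_itv /= => /negP; rewrite negb_and -!ltNge => xJ.
    rewrite lee_fin; case/orP : xJ => xs; nra.
apply: ge0_subset_integral => //; first exact: measurableC.
- by apply/measurable_EFinP; apply: measurable_funX.
- by move=> x _; rewrite lee_fin sqr_ge0.
Qed.

Lemma ge0_integral_opp (f : R -> \bar R) : measurable_fun [set: R] f ->
  (forall x, 0 <= f x)%E ->
  (\int[leb]_x f (- x)%R = \int[leb]_x f x)%E.
Proof.
move=> mf f0.
transitivity (\int[pushforward leb (-%R : _ -> measurableTypeR R)]_x f x)%E.
  by rewrite ge0_integral_pushforward.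
by apply: eq_measure_integral => A mA _; exact: lebesgue_measureN.
Qed.

Lemma mean_normal_prob (s : R) : 0 < s ->
  (\int[normal_prob 0 s]_x x%:E = 0)%E.
Proof.
move=> s0; have i1 := integrable_normal_prob_id s0.
rewrite integralE.
have -> : (\int[normal_prob 0 s]_x ((fun x => x%:E)^\- x) =
           \int[normal_prob 0 s]_x ((fun x => x%:E)^\+ x))%E.
  have mf := measurable_int _ i1.
  rewrite !ge0_integral_normal_prob //;
    [|exact: measurable_funepos|exact: measurable_funeneg].
  rewrite -[RHS]ge0_integral_opp //.
  - apply: eq_integral => x _; congr (_ * _%:E)%E;
    first by rewrite funeposE funenegE EFinN.
    by rewrite !normal_pdfE ?gt_eqF // /normal_fun !subr0 sqrrN.
  - apply: emeasurable_funM; first exact: measurable_funepos.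
    by apply/measurable_EFinP; exact: measurable_normal_pdf.
  - by move=> x; rewrite mule_ge0 // lee_fin normal_pdf_ge0.
by rewrite subee // integrable_pos_fin_num.
Qed.
End gaussian_moments.

(** * Independence and the augmented Brownian filtration *)

Section independence.
Context d d' (Omega : measurableType d) (T : measurableType d') (R : realType)
  (P : probability Omega R).

(** The joint law of X and Y is a product measure, so the claim is Fubini's
    theorem. *)
Lemma independent_expectation (nu : probability T R)
    (X : Omega -> R) (Y : Omega -> T) (phi : T -> R) :
  measurable_fun [set: Omega] X -> measurable_fun [set: Omega] Y ->
  (forall (A : set R) (C : set T), measurable A -> measurable C ->
    P (X @^-1` A `&` Y @^-1` C) = (P (X @^-1` A) * nu C)%E) ->
  P.-integrable [set: Omega] (EFin \o X) ->
  nu.-integrable [set: T] (EFin \o phi) ->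
  P.-integrable [set: Omega] (EFin \o (fun w => X w * phi (Y w))) /\
  \int[P]_w (X w * phi (Y w)) = (\int[P]_w X w) * (\int[nu]_x phi x).
Proof.
move=> mX mY XY iX iphi.
have mphi : measurable_fun [set: T] phi.
  by apply/measurable_EFinP; exact: (measurable_int nu).
have mZ : measurable_fun [set: Omega] (fun w => (X w,
  Y w)) by exact: measurable_fun_pair.
pose X' : {RV P >-> R} := mfun_Sub (mem_set mX).
pose Z' : {mfun Omega >-> (R * T)%type} := mfun_Sub (mem_set mZ).
have prodE : forall S : set (R * T), measurable S ->
    (distribution P X' \x nu)%E S = distribution P Z' S.
  by apply: product_measure_unique => A C mA mC; rewrite -XY.
pose f (z : R * T) : \bar R := (z.1 * phi z.2)%:E.
have mf : measurable_fun setT f.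
  apply/measurable_EFinP; apply: measurable_funM => //.
  by apply: measurableT_comp => //.
have dX (h : R -> \bar R) : measurable_fun [set: R] h -> (forall x, 0 <= h x)%E ->
   (\int[distribution P X']_x h x = \int[P]_w h (X w))%E.
  by move=> mh h0; rewrite ge0_integral_distribution.
have intf : (distribution P X' \x nu)%E.-integrable setT f.
  apply/integrable12ltyP => //.
  rewrite (eq_integral (fun x : R => `|x%:E| * \int[nu]_y `|(phi y)%:E|)%E); last first.
    move=> x _; rewrite -ge0_integralZl //; last by apply: measurableT_comp => //;
      exact/measurable_EFinP.
    by apply: eq_integral => y _; rewrite /f /= normrM EFinM.
  have [_ p1] := integrableP _ _ _ iphi; have [_ x1] := integrableP _ _ _ iX.
  rewrite dX //; last 2 first.
  - by apply: emeasurable_funM => //; apply: measurableT_comp => //;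
    exact/measurable_EFinP.
  - by move=> x; rewrite mule_ge0 ?integral_ge0.
  rewrite ge0_integralZr ?integral_ge0 //; last first.
    by apply: measurableT_comp => //; exact/measurable_EFinP.
  by rewrite lte_mul_pinfty ?integral_ge0 // ge0_fin_numE ?integral_ge0.
have ifZ : P.-integrable [set: Omega] (EFin \o (fun w => X w * phi (Y w))).
  apply/integrableP; split.
    by apply/measurable_EFinP; apply: measurable_funM => //; exact: measurableT_comp.
  have [_] := integrableP _ _ _ intf.
  rewrite (eq_measure_integral (distribution P Z')); last by move=> A mA _;
    exact: prodE.
  by rewrite ge0_integral_distribution //; exact: measurableT_comp.
split=> //.
rewrite /Rintegral.
have -> : (\int[P]_w (X w * phi (Y w))%:E = \int[distribution P Z']_z f z)%E.
  by rewrite integral_distribution.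
rewrite (eq_measure_integral (distribution P X' \x nu)%E); last first.
  by move=> A mA _; apply/esym; exact: prodE.
rewrite -integral12_prod_meas1 //.
have -> : (\int[distribution P X']_x fubini_F nu f x = \int[distribution P X']_x
  (x%:E * \int[nu]_y (phi y)%:E))%E.
  by apply: eq_integral => x _; rewrite /fubini_F /f /= -integralZl.
rewrite integral_distribution.
- have : (\int[nu]_y (phi y)%:E)%E \is a fin_num by exact: integrable_fin_num.
  case: (\int[nu]_y (phi y)%:E)%E => [m| |] // _ /=.
  rewrite (@integralZr _ _ _ P setT measurableT (EFin \o X) iX m).
  by rewrite fineM //; exact: integrable_fin_num.
- by apply: emeasurable_funM => //; exact/measurable_EFinP.
- have : (\int[nu]_y (phi y)%:E)%E \is a fin_num by exact: integrable_fin_num.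
  case: (\int[nu]_y (phi y)%:E)%E => [m| |] // _ /=.
  by have := integrableZr measurableT m iX; apply: eq_integrable.
Qed.
End independence.

Section augmented_filtration.
Context d (Omega : measurableType d) (R : realType) (P : probability Omega R).
Hypothesis P_complete : measure_is_complete P.
Variable B : R -> Omega -> R.
Hypothesis BM : brownian_motion P B.
Notation F := (augmented_filtration P B).

(** Omega with the sigma-algebra F_t, so that F_t-measurable maps are
    measurable functions in the usual sense. *)
Definition information (t : R) : measurableType _ :=
  g_sigma_algebraType (natural_events B t `|` P.-negligible).

Lemma augmented_filtration_le (s t : R) : s <= t -> F s `<=` F t.
Proof.
move=> st; apply: smallest_sub; first exact: smallest_sigma_algebra.
move=> A HA; apply: sub_gen_smallest; case: HA => [|nA]; last by right.
move=> [u [C [/andP[u0 us] mC ->]]]; left; exists u, C; split => //.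
by rewrite u0 (le_trans us).
Qed.

Lemma augmented_filtration_measurable (t : R) : F t `<=` measurable.
Proof.
apply: smallest_sub; first exact: sigma_algebra_measurable.
move=> A [[u [C [/andP[u0 _] mC ->]]]|/P_complete//].
by rewrite -[X in measurable X]setTI; exact: (bm_measurable BM u0).
Qed.

Lemma information_sub (t : R) d' (T : measurableType d') (f : Omega -> T) :
  measurable_fun [set: information t] (f : information t -> T) ->
  measurable_fun [set: Omega] f.
Proof.
move=> mf _ C mC; rewrite setTI; apply: (@augmented_filtration_measurable t).
by have := mf measurableT C mC; rewrite setTI.
Qed.

Lemma information_le (s t : R) d' (T : measurableType d') (f : Omega -> T) : s <= t ->
  measurable_fun [set: information s] (f : information s -> T) ->
  measurable_fun [set: information t] (f : information t -> T).
Proof.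
move=> st mf _ C mC; rewrite setTI; apply: (augmented_filtration_le st).
by have := mf measurableT C mC; rewrite setTI.
Qed.

Lemma measure_symdiff_negligible (A A' : set Omega) : measurable A -> measurable A' ->
  P.-negligible ((A `\` A') `|` (A' `\` A)) -> P A = P A'.
Proof.
have le (E E' : set Omega) : measurable E -> measurable E' ->
    P.-negligible ((E `\` E') `|` (E' `\` E)) -> (P E <= P E')%E.
  move=> mE mE' [N [mN N0 sub]]; apply: (@le_trans _ _ (P (E' `|` N))).
    apply: le_measure; rewrite ?inE //; first exact: measurableU.
    move=> w Ew; have [E'w|nE'w] := pselect (E' w); [by left|right].
    by apply: sub; left.
  by rewrite -[leRHS]adde0 -N0; exact: measureU2.
move=> mA mA' n; apply/eqP; rewrite eq_le le //= le //.
by rewrite setUC.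
Qed.

(** The sets with this property form a sigma-algebra, which contains the natural
    events and the null sets. *)
Lemma augmented_filtration_natural (s : R) (A : set Omega) : F s A ->
  exists2 A', <<s natural_events B s >> A' &
    P.-negligible ((A `\` A') `|` (A' `\` A)).
Proof.
pose G : set (set Omega) := [set A | exists2 A', <<s natural_events B s >> A' &
    P.-negligible ((A `\` A') `|` (A' `\` A))].
suff : F s `<=` G by exact.
have sN : sigma_algebra setT <<s natural_events B s >> by exact: smallest_sigma_algebra.
case: (sN) => N0 NC NU.
apply: smallest_sub.
- split.
  + by exists set0 => //; rewrite setDv setU0; exact: negligible_set0.
  + move=> E [E' NE' nE]; exists (setT `\` E'); first exact: NC.
    apply: negligibleS nE => w; rewrite !setTD /= => -[[a b]|[a b]].
    * by right; split => //; exact: contrapT.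
    * by left; split => //; exact: contrapT.
  + move=> E GE.
    have /choice[E' E'P] : forall n, exists A', <<s natural_events B s >> A' /\
      P.-negligible ((E n `\` A') `|` (A' `\` E n)).
      by move=> n; have [A' ? ?] := GE n; exists A'.
    exists (\bigcup_n E' n); first by apply: NU => n; have [] := E'P n.
    have : P.-negligible (\bigcup_n ((E n `\` E' n) `|` (E' n `\` E n))).
      by apply: negligible_bigcup => n; have [] := E'P n.
    apply: negligibleS => w [[[n _ En] nE']|[[n _ En] nE']]; exists n => //.
    * by left; split => // E'n; apply: nE'; exists n.
    * by right; split => // E'n; apply: nE'; exists n.
- move=> E [NE|nE].
  + exists E; first exact: sub_gen_smallest.
    by rewrite setDv setU0; exact: negligible_set0.
  + exists set0 => //; apply: negligibleS nE.
    by move=> w [[]|[]].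
Qed.

(** Changing an event by a null set changes no probability, so independence from
    the natural filtration carries over. *)
Lemma augmented_independent_increment (s t : R) (A : set Omega)
    (C : set (measurableTypeR R)) : 0 <= s < t -> F s A -> measurable C ->
  P (A `&` [set w | C (B t w - B s w)]) =
  (P A * normal_prob 0 (Num.sqrt (t - s)) C)%E.
Proof.
move=> st FA mC; have [s0 /ltW st'] := andP st.
have [A' NA' nA] := augmented_filtration_natural FA.
have FA' : F s A'.
  move: A' NA' {nA}; apply: smallest_sub; first exact: smallest_sigma_algebra.
  by move=> E NE; apply: sub_gen_smallest; left.
have mA := augmented_filtration_measurable FA.
have mA' := augmented_filtration_measurable FA'.
have mD : measurable [set w | C (B t w - B s w)].
  rewrite -[X in measurable X]setTI.
  apply: (measurable_funB (bm_measurable BM (le_trans s0 st')) (bm_measurable BM s0))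
    => //.
rewrite -(bm_gaussian BM) // (@measure_symdiff_negligible A A') //.
rewrite -(bm_independent BM) //.
apply: measure_symdiff_negligible; [exact: measurableI|exact: measurableI|].
by apply: negligibleS nA => w [[[a b] c]|[[a b] c]]; [left|right]; split => // ?;
  apply: c.
Qed.

End augmented_filtration.

(** * Stopped martingale transforms of Brownian increments *)

Lemma bounded_integrable d (T : measurableType d) (R : realType)
    (P : probability T R) (f : T -> R) (K : R) :
  measurable_fun [set: T] f -> (forall w, `|f w| <= K) ->
  P.-integrable [set: T] (EFin \o f).
Proof.
move=> mf fK; apply: (measurable_bounded_integrable measurableT) => //.
  by rewrite -ge0_fin_numE // fin_num_measure.
exists K; split; first exact: num_real.
by move=> M KM w _; exact: le_trans (fK w) (ltW KM).
Qed.

Section increments.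
Context d (Omega : measurableType d) (R : realType) (P : probability Omega R).
Hypothesis P_complete : measure_is_complete P.
Variable B : R -> Omega -> R.
Hypothesis BM : brownian_motion P B.
Notation F := (augmented_filtration P B).
Notation info := (information P B).

Lemma increment_expectation (s t K : R) (eta : Omega -> R) (phi : R -> R) :
  0 <= s < t -> measurable_fun [set: info s] (eta : info s -> R) ->
  (forall w, `|eta w| <= K) ->
  (normal_prob 0 (Num.sqrt (t - s))).-integrable [set: measurableTypeR R] (EFin \o
    phi) ->
  P.-integrable [set: Omega] (EFin \o (fun w => eta w * phi (B t w - B s w))) /\
  \int[P]_w (eta w * phi (B t w - B s w)) =
    (\int[P]_w eta w) * \int[normal_prob 0 (Num.sqrt (t - s))]_x phi x.
Proof.
move=> st meta etaK iphi; have [s0 /ltW st'] := andP st.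
have meta' := information_sub P_complete BM meta.
apply: (@independent_expectation _ _ _ _ _ _ (normal_prob 0 (Num.sqrt (t - s))) eta
  (fun w => B t w - B s w) phi) => //.
- exact: measurable_funB (bm_measurable BM (le_trans s0 st')) (bm_measurable BM s0).
- move=> A C mA mC; apply: (augmented_independent_increment P_complete BM) => //.
  by have := meta measurableT A mA; rewrite setTI.
- exact: bounded_integrable meta' etaK.
Qed.

Lemma increment_mean (s t K : R) (eta : Omega -> R) :
  0 <= s <= t -> measurable_fun [set: info s] (eta : info s -> R) ->
  (forall w, `|eta w| <= K) ->
  P.-integrable [set: Omega] (EFin \o (fun w => eta w * (B t w - B s w))) /\
  \int[P]_w (eta w * (B t w - B s w)) = 0.
Proof.
move=> /andP[s0]; rewrite le_eqVlt => /predU1P[<-|st] meta etaK.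
  under [X in EFin \o X]eq_fun do rewrite subrr mulr0.
  under eq_Rintegral do rewrite subrr mulr0.
  by split; [exact: integrable0|rewrite /Rintegral integral0].
have v0 : 0 < Num.sqrt (t - s) by rewrite sqrtr_gt0 subr_gt0.
have [|i ->] := @increment_expectation s t K eta id _ meta etaK
  (integrable_normal_prob_id v0).
  by rewrite s0.
by split => //; rewrite /Rintegral mean_normal_prob // mulr0.
Qed.

(** The factor 8 comes from the crude lower bound on the variance. *)
Lemma increment_second_moment (s t K : R) (eta : Omega -> R) :
  0 <= s <= t -> measurable_fun [set: info s] (eta : info s -> R) ->
  (forall w, 0 <= eta w <= K) ->
  P.-integrable [set: Omega] (EFin \o (fun w => eta w * (B t w - B s w) ^+ 2)) /\
  (t - s) * (\int[P]_w eta w) <= 8 * \int[P]_w (eta w * (B t w - B s w) ^+ 2).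
Proof.
move=> /andP[s0]; rewrite le_eqVlt => /predU1P[<-|st] meta etaK.
  have -> : (fun w => eta w * (B s w - B s w) ^+ 2) = (fun=> 0).
    by apply/funext => w; rewrite subrr expr0n mulr0.
  by split; [exact: integrable0|rewrite /Rintegral integral0 subrr mul0r mulr0].
have v0 : 0 < Num.sqrt (t - s) by rewrite sqrtr_gt0 subr_gt0.
have i2 := integrable_normal_prob_pow2 v0.
have [||i ->] := @increment_expectation s t K eta (fun x => x ^+ 2) _ meta _ i2.
- by rewrite s0.
- by move=> w; have /andP[e0 eK] := etaK w; rewrite ger0_norm.
split => //.
have eta0 : 0 <= \int[P]_w eta w by apply: Rintegral_ge0 => w _; have /andP[] := etaK w.
have : (t - s) / 8 <= \int[normal_prob 0 (Num.sqrt (t - s))]_x (x ^+ 2).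
  rewrite -lee_fin fineK; last exact: integrable_fin_num.
  have := second_moment_normal_prob_ge v0.
  by rewrite sqr_sqrtr // subr_ge0 ltW.
move: eta0; move: (\int[P]_w eta w) (\int[normal_prob 0 (Num.sqrt (t - s))]_x (x ^+ 2)).
by clear=> E m E0 H; nra.
Qed.

Lemma increment_fourth_moment (s t : R) : 0 <= s <= t ->
  P.-integrable [set: Omega] (EFin \o (fun w => (B t w - B s w) ^+ 4)) /\
  \int[P]_w ((B t w - B s w) ^+ 4) <= 128 * (t - s) ^+ 2.
Proof.
move=> /andP[s0]; rewrite le_eqVlt => /predU1P[<-|st].
  have -> : (fun w => (B s w - B s w) ^+ 4) = (fun=> 0).
    by apply/funext => w; rewrite subrr expr0n.
  by split; [exact: integrable0|rewrite /Rintegral integral0 subrr expr0n mulr0].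
have v0 : 0 < Num.sqrt (t - s) by rewrite sqrtr_gt0 subr_gt0.
have i4 := integrable_normal_prob_pow4 v0.
have [|||] := @increment_expectation s t 1 (cst 1) (fun x => x ^+ 4) _ _ _ i4.
- by rewrite s0.
- exact: measurable_cst.
- by move=> w; rewrite normr1.
have -> : (fun w => cst 1 w * (B t w - B s w) ^+ 4) = (fun w => (B t w - B s w) ^+ 4).
  by apply/funext => w; rewrite mul1r.
move=> i ->; split => //.
rewrite Rintegral_cst // mul1r.
have -> : fine (P [set: Omega]) = 1 by rewrite probability_setT.
rewrite mul1r -lee_fin fineK; last exact: integrable_fin_num.
apply: le_trans (fourth_moment_normal_prob v0) _.
by rewrite lee_fin (exprM _ 2 2) sqr_sqrtr // subr_ge0 ltW.
Qed.

End increments.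

Section stopped_transform.
Context d (Omega : measurableType d) (R : realType) (P : probability Omega R).
Hypothesis P_complete : measure_is_complete P.
Variable B : R -> Omega -> R.
Hypothesis BM : brownian_motion P B.
Notation F := (augmented_filtration P B).
Notation info := (information P B).

Variables (c : nat -> R) (xi : nat -> Omega -> R) (tau : Omega -> R) (a K : R).
Hypothesis c0 : 0 <= c 0%N.
Hypothesis c_homo : forall k, c k <= c k.+1.
Hypothesis xi_measurable : forall k,
  measurable_fun [set: info (c k)] (xi k : info (c k) -> R).
Hypothesis xi_bounded : forall k w, `|xi k w| <= K.
Hypothesis tau_stopping : forall k, F (c k) [set w | tau w <= c k].
Hypothesis a_gt0 : 0 < a.

Let dB k w := B (c k.+1) w - B (c k) w.

(** The k-th increment is still added if tau has not passed at c_k and the sum S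
    has not left ]- a, a[.  Both conditions are known at time c_k, and the second
    one fails for good once the sum has left, as the sum no longer moves. *)
Definition active (S : R) (k : nat) (w : Omega) : bool :=
  (c k < tau w) && (`|S| < a).

Fixpoint stopped_sum (k : nat) (w : Omega) : R :=
  if k is j.+1 then
    stopped_sum j w +
      (if active (stopped_sum j w) j w then xi j w else 0) * dB j w
  else 0.

Definition stopped_coef (k : nat) (w : Omega) : R :=
  if active (stopped_sum k w) k w then xi k w else 0.

Definition stopped_bracket (k : nat) (w : Omega) : R :=
  \sum_(j < k) stopped_coef j w ^+ 2 * (c j.+1 - c j).

Lemma stopped_sumS k w :
  stopped_sum k.+1 w = stopped_sum k w + stopped_coef k w * dB k w.
Proof. by []. Qed.

Let c_ge0 k : 0 <= c k.
Proof. by elim: k => // k /le_trans; apply. Qed.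

Let c_itv k : 0 <= c k <= c k.+1.
Proof. by rewrite c_ge0 c_homo. Qed.

Let K_ge0 : 0 <= K.
Proof. by apply: le_trans (xi_bounded 0 point). Qed.

Let B_measurable k : measurable_fun [set: info (c k)] (B (c k) : info (c k) -> R).
Proof.
move=> _ C mC; rewrite setTI; apply: sub_gen_smallest; left.
by exists (c k), C; split => //; rewrite c_ge0 lexx.
Qed.

Let coef_of_sum k : measurable_fun [set: info (c k)] (stopped_sum k : info (c k) ->
  R) ->
  measurable_fun [set: info (c k)] (stopped_coef k : info (c k) -> R).
Proof.
move=> mS; apply: measurable_fun_ifT => //.
apply: measurable_and.
- apply: (@measurable_fun_bool _ (info (c k)) _ _ true).
  rewrite setTI.
  have := measurableC (@tau_stopping k : measurable (_ : set (info (c k)))).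
  congr (measurable _); apply/seteqP; split => w /=.
    by rewrite ltNge => /negP.
  by rewrite ltNge => /negP.
- apply: measurable_fun_ltr => //.
  exact: measurableT_comp.
Qed.

Lemma stopped_sum_measurable k :
  measurable_fun [set: info (c k)] (stopped_sum k : info (c k) -> R).
Proof.
elim: k => [|k IH]; first exact: measurable_cst.
apply: measurable_funD; first exact: information_le (c_homo k) IH.
apply: measurable_funM; first exact: information_le (c_homo k) (coef_of_sum IH).
apply: measurable_funB;
  [exact: B_measurable|exact: information_le (c_homo k) (@B_measurable k)].
Qed.

Lemma stopped_coef_measurable k :
  measurable_fun [set: info (c k)] (stopped_coef k : info (c k) -> R).
Proof. by apply: coef_of_sum; exact: stopped_sum_measurable. Qed.

Lemma stopped_coef_le k w : `|stopped_coef k w| <= K.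
Proof. by rewrite /stopped_coef; case: ifP => // _; rewrite normr0. Qed.

Lemma stopped_sum_mean k :
  P.-integrable [set: Omega] (EFin \o stopped_sum k) /\ \int[P]_w stopped_sum k w = 0.
Proof.
elim: k => [|k [iS ES]].
  by split; [exact: integrable0|rewrite /Rintegral integral0].
have [iD ED] := increment_mean P_complete BM (c_itv k) (@stopped_coef_measurable k)
  (@stopped_coef_le k).
split; first by apply: eq_integrable (integrableD measurableT iS iD).
by rewrite (RintegralD measurableT iS iD) ES ED addr0.
Qed.

Let scoef_measurable k :
  measurable_fun [set: info (c k)] ((fun w => stopped_coef k w ^+ 2) : info (c k) -> R).
Proof. by apply: measurable_funX; exact: stopped_coef_measurable. Qed.

Let scoef_le k w : 0 <= stopped_coef k w ^+ 2 <= K ^+ 2.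
Proof. by rewrite sqr_ge0 -real_normK ?num_real // lerXn2r ?nnegrE ?stopped_coef_le.
  Qed.

Let scoef_integrable k : P.-integrable [set: Omega] (EFin \o (fun w =>
  stopped_coef k w ^+ 2)).
Proof.
apply: (@bounded_integrable _ _ _ _ _ (K ^+ 2)).
  by apply: (information_sub P_complete BM); exact: scoef_measurable.
by move=> w; have /andP[? ?] := scoef_le k w; rewrite ger0_norm.
Qed.

Lemma stopped_bracket_integrable k :
  P.-integrable [set: Omega] (EFin \o stopped_bracket k).
Proof.
elim: k => [|k IH].
  rewrite (_ : _ \o _ = (fun=> 0%E)); first exact: integrable0.
  by apply/funext => w; rewrite /= /stopped_bracket big_ord0.
have := integrableD measurableT IH (integrableZr measurableT (c k.+1 - c k)
  (scoef_integrable k)).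
by apply: eq_integrable => // w _; rewrite /= /stopped_bracket big_ord_recr.
Qed.

(** In the square of a partial sum the cross term has mean zero: its coefficient
    is bounded, since the sum lies in ]- a, a[ as long as it moves. *)
Lemma stopped_sum_second_moment k :
  P.-integrable [set: Omega] (EFin \o (fun w => stopped_sum k w ^+ 2)) /\
  \int[P]_w stopped_bracket k w <= 8 * \int[P]_w (stopped_sum k w ^+ 2).
Proof.
elim: k => [|k [iS ES]].
  have -> : (fun w => stopped_sum 0 w ^+ 2) = (fun=> 0).
    by apply/funext => w; rewrite expr0n.
  have -> : stopped_bracket 0 = (fun=> 0).
    by apply/funext => w; rewrite /stopped_bracket big_ord0.
  by split; [exact: integrable0|rewrite /Rintegral integral0 mulr0].
have [i2 E2] := increment_second_moment P_complete BM (c_itv k) (@scoef_measurable k)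
  (@scoef_le k).
have mcross : measurable_fun [set: info (c k)]
    ((fun w => 2 * stopped_sum k w * stopped_coef k w) : info (c k) -> R).
  apply: measurable_funM; last exact: stopped_coef_measurable.
  by apply: measurable_funM => //; exact: stopped_sum_measurable.
have cross_le w : `|2 * stopped_sum k w * stopped_coef k w| <= 2 * a * K.
  rewrite /stopped_coef; case: ifP => [/andP[_ /ltW Sa]|_].
    by rewrite !normrM (ger0_norm (ler0n _ 2)) ler_pM // ler_pM.
  by rewrite mulr0 normr0 !mulr_ge0 // ltW.
have [i1 E1] := increment_mean P_complete BM (c_itv k) mcross cross_le.
have SE : (fun w => stopped_sum k.+1 w ^+ 2) = (fun w => (stopped_sum k w ^+ 2 +
    2 * stopped_sum k w * stopped_coef k w * (B (c k.+1) w - B (c k) w)) +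
    stopped_coef k w ^+ 2 * (B (c k.+1) w - B (c k) w) ^+ 2).
  by apply/funext => w; rewrite stopped_sumS /dB; ring.
have VE : stopped_bracket k.+1 =
    (fun w => stopped_bracket k w + stopped_coef k w ^+ 2 * (c k.+1 - c k)).
  by apply/funext => w; rewrite /stopped_bracket big_ord_recr.
have iS1 := integrableD measurableT iS i1.
rewrite SE VE; split; first by apply: eq_integrable (integrableD measurableT iS1 i2).
rewrite (RintegralD measurableT iS1 i2) (RintegralD measurableT iS i1) E1 addr0 mulrDr.
rewrite RintegralD //; last 2 first.
- exact: stopped_bracket_integrable.
- exact: (integrableZr measurableT (c k.+1 - c k) (scoef_integrable k)).
by apply: lerD => //; rewrite RintegralZr // mulrC.
Qed.

(** The sum is frozen as soon as it leaves ]-a, a[; hence it can be large only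
    if the last increment before freezing is. *)
Lemma stopped_sum_overshoot k w : `|stopped_sum k w| <= 2 * a \/
  stopped_sum k w ^+ 2 <= 4 * K ^+ 4 / a ^+ 2 * \sum_(j < k) dB j w ^+ 4.
Proof.
have C0 : 0 <= 4 * K ^+ 4 / a ^+ 2 by rewrite divr_ge0 ?mulr_ge0 ?exprn_ge0 // ltW.
elim: k => [|k IH]; first by left; rewrite normr0 mulr_ge0 // ltW.
rewrite stopped_sumS big_ord_recr /= /stopped_coef; case: ifP => [/andP[_ Sa]|_];
  last first.
  rewrite mul0r addr0; case: IH => IH; [by left|right].
  by apply: le_trans IH _; rewrite ler_wpM2l // lerDl exprn_even_ge0.
set S := stopped_sum k w in Sa *; set x := xi k w * dB k w.
have [Sx|Sx] := leP `|S + x| (2 * a); [by left|right].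
have ax : a < `|x|.
  have := ler_normD S x; lra.
apply: (@le_trans _ _ (4 * x ^+ 2)).
  have : `|S + x| <= 2 * `|x| by have := ler_normD S x; lra.
  rewrite -[(S + x) ^+ 2]real_normK ?num_real // -[x ^+ 2]real_normK ?num_real //.
  by have := normr_ge0 (S + x); nra.
have x4 : x ^+ 2 <= x ^+ 4 / a ^+ 2.
  rewrite ler_pdivlMr ?exprn_gt0 // (exprM x 2 2) [leRHS]expr2 ler_wpM2l ?sqr_ge0 //.
  by rewrite -[x ^+ 2]real_normK ?num_real // lerXn2r ?nnegrE ?(ltW ax) ?(ltW a_gt0).
have xK : x ^+ 4 <= K ^+ 4 * dB k w ^+ 4.
  rewrite exprMn ler_wpM2r ?exprn_even_ge0 //.
  by rewrite !(exprM _ 2 2) lerXn2r ?nnegrE ?sqr_ge0 // -[xi k w ^+ 2]real_normK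
    ?num_real // lerXn2r ?nnegrE.
have sum0 : 0 <= \sum_(j < k) dB j w ^+ 4 by apply: sumr_ge0 => j _;
  rewrite exprn_even_ge0.
rewrite mulrDr.
apply: le_trans (_ : 4 * (x ^+ 4 / a ^+ 2) <= _); first by rewrite ler_wpM2l.
apply: le_trans (_ : 4 * K ^+ 4 / a ^+ 2 * dB k w ^+ 4 <= _);
  last by rewrite lerDr mulr_ge0.
have -> : 4 * K ^+ 4 / a ^+ 2 * dB k w ^+ 4 = 4 * (K ^+ 4 * dB k w ^+ 4 / a ^+ 2)
  by ring.
by rewrite ler_wpM2l // ler_wpM2r // invr_ge0 sqr_ge0.
Qed.

(** Of order mesh, because E (B_t - B_s)^4 is of order (t - s)^2. *)
Lemma increments_fourth_moment (mesh : R) k :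
  (forall j, c j.+1 - c j <= mesh) ->
  P.-integrable [set: Omega] (EFin \o (fun w => \sum_(j < k) dB j w ^+ 4)) /\
  \int[P]_w (\sum_(j < k) dB j w ^+ 4) <= 128 * mesh * (c k - c 0%N).
Proof.
move=> cmesh; elim: k => [|k [iS ES]].
  have -> : (fun w => \sum_(j < 0) dB j w ^+ 4) = (fun=> 0).
    by apply/funext => w; rewrite big_ord0.
  by split; [exact: integrable0|rewrite /Rintegral integral0 subrr mulr0].
have -> : (fun w => \sum_(j < k.+1) dB j w ^+ 4) =
    (fun w => (\sum_(j < k) dB j w ^+ 4) + dB k w ^+ 4).
  by apply/funext => w; rewrite big_ord_recr.
have [i4 E4] := increment_fourth_moment P_complete BM (c_itv k).
split; first by apply: eq_integrable (integrableD measurableT iS i4).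
rewrite (RintegralD measurableT iS i4).
have -> : 128 * mesh * (c k.+1 - c 0) = 128 * mesh * (c k - c 0) + 128 * mesh * (c
  k.+1 - c k) by ring.
apply: lerD => //; apply: le_trans E4 _.
rewrite -mulrA ler_wpM2l // expr2 ler_wpM2r // subr_ge0; exact: c_homo.
Qed.

End stopped_transform.

(** * Integrals of simple processes along a grid *)

Section grid.
Context (R : realType).

(** Sort the points. *)
Lemma exists_grid (s0 : seq R) (h : R) : 0 <= h ->
  (forall x, x \in s0 -> 0 <= x <= h) ->
  exists (c : nat -> R) (N : nat), [/\ c 0%N = 0, c N = h,
    (forall k, c k <= c k.+1), (forall k, c k <= h) &
    forall k x, x \in s0 -> ~ (c k < x < c k.+1)].
Proof.
move=> h0 s0h; pose s := sort <=%R (0 :: s0).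
have ss : sorted <=%R s by apply: sort_sorted; exact: le_total.
have sE x : (x \in s) = (x \in 0 :: s0) by rewrite mem_sort.
have sh x : x \in s -> 0 <= x <= h.
  by rewrite sE inE => /predU1P[->|/s0h//]; rewrite lexx.
have szs : (0 < size s)%N by rewrite size_sort.
pose c k := nth h s k.
have ch k : 0 <= c k <= h.
  have [ks|ks] := ltnP k (size s); first by apply: sh; exact: mem_nth.
  by rewrite /c nth_default // h0 lexx.
have c_mono i j : (i <= j)%N -> c i <= c j.
  move=> ij; have [js|js] := ltnP j (size s).
    by apply: sorted_leq_nth => //; [exact: le_trans|rewrite inE (leq_ltn_trans ij)].
  by rewrite [leRHS]/c nth_default //; have /andP[] := ch i.
exists c, (size s); split.
- apply/eqP; rewrite eq_le; have /andP[-> _] := ch 0%N; rewrite andbT.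
  have /(nthP h)[i _ <-] : 0 \in s by rewrite sE mem_head.
  exact: c_mono.
- by rewrite /c nth_default.
- by move=> k; exact: c_mono.
- by move=> k; have /andP[] := ch k.
- move=> k x xs; have /(nthP h)[i _ <-] : x \in s by rewrite sE inE xs orbT.
  move=> /andP[ki ik].
  have [ik'|ki'] := leqP i k; first by have := c_mono _ _ ik'; rewrite leNgt ki.
  by have := c_mono _ _ ki'; rewrite leNgt ik.
Qed.

End grid.

Section simple_integral.
Context d (Omega : measurableType d) (R : realType) (P : probability Omega R).
Variable B : R -> Omega -> R.
Notation F := (augmented_filtration P B).
Notation info := (information P B).

Variable H : simple_process Omega R.
Hypothesis H_simple : is_simple F H.

Let time_ge0 k : 0 <= sp_time H k.
Proof. by have [t0 tm _] := H_simple; apply: le_trans t0 (tm _ _ (leq0n k)). Qed.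

Let time_le k : sp_time H k <= sp_time H k.+1.
Proof. by have [_ tm _] := H_simple; exact: tm. Qed.

Lemma sp_value_bounded : exists K, forall t w, `|sp_value H t w| <= K.
Proof.
have [_ _ Hc] := H_simple.
suff [K HK] : exists K, forall w, \sum_(k < sp_size H) `|sp_coef H k w| <= K.
  exists K => t w; apply: le_trans (HK w); apply: le_trans (ler_norm_sum _ _ _) _.
  apply: ler_sum => k _; rewrite normrM ler_piMr // indicE.
  by case: (_ \in _); rewrite ?normr1 ?normr0.
move: Hc; elim: (sp_size H) => [|n IH] Hc.
  by exists 0 => w; rewrite big_ord0.
have [|K HK] := IH; first by move=> k kn; apply: Hc; exact: ltnW.
have [[M HM] _] := Hc n (ltnSn n).
by exists (K + M) => w; rewrite big_ord_recr /= lerD.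
Qed.

Definition off_times (a b : R) :=
  forall k, (k <= sp_size H)%N -> ~ (a < sp_time H k < b).

Lemma sp_value_measurable a b : a < b -> off_times a b ->
  measurable_fun [set: info a] (sp_value H b : info a -> R).
Proof.
move=> ab off; have [_ _ Hc] := H_simple.
rewrite /sp_value; apply: measurable_sum => k.
have [tb|bt] := ltP (sp_time H k) b; last first.
  rewrite (_ : (fun w => _) = (cst 0)); first exact: measurable_cst.
  apply/funext => w; rewrite indicE memNset ?mulr0 //= in_itv /=.
  by rewrite ltNge bt.
have ta : sp_time H k <= a by rewrite leNgt; apply/negP => at_;
  apply: (off k (ltnW (ltn_ord k))); rewrite at_.
apply: measurable_funM; last exact: measurable_cst.
apply: (information_le ta) => _ C mC; rewrite setTI.
by have [_] := Hc k (ltn_ord k); exact.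
Qed.

Lemma sp_value_const a b s w : off_times a b -> a < s <= b ->
  sp_value H s w = sp_value H b w.
Proof.
move=> off /andP[as_ sb]; apply: eq_bigr => k _; congr (_ * _).
rewrite !indicE; congr (nat_of_bool _)%:R; rewrite !mem_setE /= !in_itv /=.
have out j : (j <= sp_size H)%N -> ~~ (a < sp_time H j < b) by move=> /off /negP.
have := out k (ltnW (ltn_ord k)); have := out k.+1 (ltn_ord k).
move: (sp_time H k) (sp_time H k.+1) => t t'; rewrite !negb_and -!leNgt.
move=> o' o; congr (_ && _).
- apply/idP/idP => ts; first exact: lt_le_trans sb.
  by case/orP: o => [|/(lt_le_trans ts)]; [move/le_lt_trans; exact|rewrite ltxx].
- apply/idP/idP => ts; last exact: le_trans sb _.
  by case/orP: o' => [/(le_trans ts)/(lt_le_trans as_)|//]; rewrite ltxx.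
Qed.

Lemma sp_integral0 w : sp_integral B H 0 w = 0.
Proof.
rewrite /sp_integral big1 // => k _.
by rewrite !(@min_r _ _ _ 0) ?time_ge0 // subrr mulr0.
Qed.

(** Between two jump times H is constant, so its integral is the value of H at
    the right end times the increment of B. *)
Lemma sp_integral_increment a b w : a < b -> off_times a b ->
  sp_integral B H b w - sp_integral B H a w = sp_value H b w * (B b w - B a w).
Proof.
move=> ab off; rewrite /sp_integral /sp_value -sumrB mulr_suml.
apply: eq_bigr => k _; rewrite -mulrBr -mulrA; congr (_ * _).
have out j : (j <= sp_size H)%N -> ~~ (a < sp_time H j < b) by move=> /off /negP.
have := out k (ltnW (ltn_ord k)); have := out k.+1 (ltn_ord k); have := time_le k.
rewrite indicE mem_setE /= in_itv /=.
move: (sp_time H k) (sp_time H k.+1) => t t' tt'; rewrite !negb_and -!leNgt.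
have min_lo u : u <= a -> Num.min u b = u /\ Num.min u a = u.
  by move=> ua; rewrite !min_l // (le_trans ua) // ltW.
have min_hi u : b <= u -> Num.min u b = b /\ Num.min u a = a.
  by move=> bu; rewrite !min_r // (le_trans _ bu) // ltW.
case/orP => [/[dup] t'a /min_lo[-> ->]|/[dup] bt' /min_hi[-> ->]];
  case/orP => [/[dup] ta /min_lo[-> ->]|/[dup] bt /min_hi[-> ->]].
- by rewrite (leNgt b) (le_lt_trans t'a ab) andbF mul0r; ring.
- by have := lt_le_trans (le_lt_trans t'a ab) (le_trans bt tt'); rewrite ltxx.
- by rewrite (le_lt_trans ta ab) bt' mul1r; ring.
- by rewrite ltNge bt mul0r; ring.
Qed.

Lemma sp_value_measurable_time w : measurable_fun [set: R] (sp_value H ^~ w).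
Proof.
apply: measurable_sum => k; apply: measurable_funM; first exact: measurable_cst.
by apply: measurable_indic; exact: measurable_itv.
Qed.

Variable c : nat -> R.
Hypothesis c0 : c 0%N = 0.
Hypothesis c_homo : forall k, c k <= c k.+1.
Hypothesis c_off : forall k, off_times (c k) (c k.+1).

(** Value of H on ]c_k, c_(k+1)].  If this interval is empty, the value of H at
    c_(k+1) need not be known at c_k, whence the case distinction. *)
Definition grid_coef (k : nat) (w : Omega) : R :=
  if c k < c k.+1 then sp_value H (c k.+1) w else 0.

Lemma grid_coef_measurable k :
  measurable_fun [set: info (c k)] (grid_coef k : info (c k) -> R).
Proof.
rewrite /grid_coef; have [ck|_] := ltP (c k) (c k.+1); last exact: measurable_cst.
by apply: sp_value_measurable => //; exact: c_off.
Qed.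

Lemma sp_integral_gridS k w : sp_integral B H (c k.+1) w =
  sp_integral B H (c k) w + grid_coef k w * (B (c k.+1) w - B (c k) w).
Proof.
rewrite /grid_coef; case: ifP => ck.
  by rewrite -(sp_integral_increment w ck (@c_off k)) addrC subrK.
have -> : c k.+1 = c k by apply/eqP; rewrite eq_le c_homo leNgt ck.
by rewrite subrr mulr0 addr0.
Qed.

Lemma integral_sp_value_sqr k w :
  (\int[lebesgue_measure]_(s in `[0%R, c k]) (sp_value H s w ^+ 2)%:E =
   (\sum_(j < k) grid_coef j w ^+ 2 * (c j.+1 - c j))%:E)%E.
Proof.
have m2 (D : set R) : measurable D ->
    measurable_fun D (fun s => (sp_value H s w ^+ 2)%:E).
  move=> mD; apply/measurable_EFinP/measurable_funTS.
  by apply: measurable_funX; exact: sp_value_measurable_time.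
elim: k => [|k IH].
  by rewrite big_ord0 c0 set_itv1 integral_set1.
have ck0 : 0 <= c k by elim: (k) => [|j IHj]; [rewrite c0|exact: le_trans IHj _].
have -> : `[0, c k.+1]%classic = `[0, c k]%classic `|` `]c k, c k.+1]%classic.
  by rewrite -itv_bndbnd_setU // bnd_simp.
rewrite ge0_integral_setU //; first last.
- by rewrite disj_set2E; apply/eqP; rewrite -subset0 => z [] /=;
  rewrite !in_itv /= => /andP[_ zc] /andP[]; rewrite ltNge zc.
- by move=> z _; rewrite lee_fin sqr_ge0.
- by apply: m2; exact: measurableU.
rewrite IH big_ord_recr /= EFinD; congr (_ + _)%E.
rewrite (eq_integral (fun=> (grid_coef k w ^+ 2)%:E)); last first.
  move=> s; rewrite inE /= in_itv /= => /andP[cs sc].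
  rewrite /grid_coef (lt_le_trans cs sc).
  by rewrite (@sp_value_const (c k) (c k.+1)) ?cs //; exact: c_off.
rewrite integral_cst //= lebesgue_measure_itv /= lte_fin.
case: ifP => ck; first by rewrite -EFinB -EFinM.
by rewrite /grid_coef ck expr0n mul0e mul0r.
Qed.

End simple_integral.

(** * Continuous paths *)

Section paths.
Context (R : realType).

Lemma continuous_clamp (f : R -> R) : {within `[0, +oo[%classic, continuous f} ->
  continuous (fun s : R => f (Num.max s 0)).
Proof.
move=> /subspace_continuousP cf x.
have m0 (y : R) : `[0, +oo[%classic (Num.max y 0).
  by rewrite /= in_itv /= andbT le_max lexx orbT.
have cm : continuous (fun s : R => Num.max s 0).
  by move=> y; apply: (@continuous_max _ _ id (cst 0)) => //; exact: cvg_cst.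
apply: cvg_trans (cf _ (m0 x)) => U /= wU.
by apply: (@filterS _ (nbhs x) _ _ _ _ (cm x _ wU)) => y; apply; exact: m0.
Qed.

(** Rational times suffice, so that events on a whole path are countable unions. *)
Lemma exists_gt_ratP (f : R -> R) (t e : R) : 0 <= t -> continuous f ->
  (exists2 s, 0 <= s <= t & e < f s) <->
  (exists q : rat, e < f (Num.min (Num.max (ratr q) 0) t)).
Proof.
move=> t0 cf; split => [[s st es]|[q eq]]; last first.
  by exists (Num.min (Num.max (ratr q) 0) t) => //;
    rewrite le_min ge_min lexx orbT t0 le_max lexx !orbT.
have clamp : continuous (fun s : R => Num.min (Num.max s 0) t).
  move=> y; have cm : {for y, continuous (fun s : R => Num.max s 0)}.
    by apply: (@continuous_max _ _ id (cst 0)) => //; exact: cvg_cst.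
  exact: (continuous_min cm (@cst_continuous R R t y)).
have cs : Num.min (Num.max s 0) t = s.
  by case/andP: st => s0 s1; rewrite max_l // min_l.
have : \forall y \near s, e < f (Num.min (Num.max y 0) t).
  have ccf : {for s, continuous (fun y : R => f (Num.min (Num.max y 0) t))}.
    by apply: continuous_comp; [exact: clamp|exact: cf].
  apply: (cvgr_gt (f (Num.min (Num.max s 0) t)) ccf).
  by rewrite cs.
case=> r /= r0 Hr.
have [q] : exists q : rat, (ratr q : R) \in `]s - r, s + r[.
  by apply: rat_in_itvoo; lra.
rewrite in_itv /= => /andP[q1 q2]; exists q; apply: Hr.
by rewrite /ball_ /= ltr_norml; lra.
Qed.

Lemma measurable_exists_gt d (T : measurableType d) (f : R -> T -> R) (t e : R) :
  0 <= t -> (forall w, continuous (f ^~ w)) ->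
  (forall s, 0 <= s <= t -> measurable_fun [set: T] (f s)) ->
  measurable [set w | exists2 s, 0 <= s <= t & e < f s w].
Proof.
move=> t0 cf mf.
have -> : [set w | exists2 s, 0 <= s <= t & e < f s w] =
  \bigcup_(q in [set: rat]) [set w | e < f (Num.min (Num.max (ratr q) 0) t) w].
  apply/seteqP; split => w /=.
    by move=> /(exists_gt_ratP e t0 (cf w))[q eq]; exists q.
  by case=> q _ eq; apply/(exists_gt_ratP e t0 (cf w)); exists q.
apply: bigcupT_measurable_rat => q.
have qt : 0 <= Num.min (Num.max (ratr q) 0) t <= t.
  by rewrite le_min ge_min lexx orbT t0 le_max lexx !orbT.
have := mf _ qt measurableT _ (measurable_itv `]e, +oo[).
by rewrite setTI preimage_itvoy.
Qed.

(** On a compact time interval f reaches e if and only if it exceeds every level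
    below e. *)
Lemma measurable_exists_ge d (T : measurableType d) (f : R -> T -> R) (t e : R) :
  0 <= t -> (forall w, continuous (f ^~ w)) ->
  (forall s, 0 <= s <= t -> measurable_fun [set: T] (f s)) ->
  measurable [set w | exists2 s, 0 <= s <= t & e <= f s w].
Proof.
move=> t0 cf mf.
have -> : [set w | exists2 s, 0 <= s <= t & e <= f s w] =
  \bigcap_(n in [set: nat]) [set w | exists2 s, 0 <= s <= t & e - n.+1%:R^-1 < f s w].
  apply/seteqP; split => w /=.
    move=> [s st es] n _; exists s => //.
    have n0 : 0 < n.+1%:R^-1 :> R by rewrite invr_gt0.
    by rewrite ltrBlDr; apply: le_lt_trans es _; rewrite ltrDl.
  move=> H.
  have [|s] := @EVT_max R (f ^~ w) 0 t t0; first by apply: continuous_subspaceT;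
    exact: cf.
  rewrite in_itv /= => st sM; exists s => //.
  rewrite leNgt; apply/negP => /ltr_add_invr[n fn].
  have [s' st' es'] := H n I.
  have := sM s'; rewrite in_itv /= => /(_ st').
  by rewrite leNgt; apply/negP/negPn; apply: lt_trans es'; rewrite ltrBrDr.
by apply: bigcapT_measurable => n; exact: measurable_exists_gt.
Qed.

(** The minimum of a nonempty compact set of times. *)
Lemma exists_hitting_time (f : R -> R) (dl h : R) : 0 <= h -> continuous f ->
  exists t, [/\ 0 <= t <= h, (forall s, 0 <= s < t -> `|f s| < dl) &
    t < h -> dl <= `|f t|].
Proof.
move=> h0 cf.
have cnf : continuous (fun s => `|f s|) by move=> s; apply: cvg_norm; exact: cf.
pose A := [set s | 0 <= s <= h] `&` ([set s | dl <= `|f s|] `|` [set h]).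
have cA : compact A.
  apply: compact_closedI.
    rewrite (_ : [set _ | _] = `[0, h]%classic); first exact: segment_compact.
    by apply/seteqP; split => s /=; rewrite in_itv.
  apply: closedU; last exact: (@closed_eq R h).
  rewrite (_ : mkset _ = (fun s => `|f s|) @^-1` [set x | dl <= x]) //.
  apply: closed_comp => [x _|]; [exact: cnf|exact: closed_ge].
have A0 : A !=set0 by exists h; split; [rewrite /= h0 lexx|right].
have cid : {within A, continuous (id : R -> R)}.
  by apply: continuous_subspaceT => s; exact: cvg_id.
have [t] := compact_EVT_min A0 cA cid.
rewrite inE => -[th tA] tmin; exists t; split => //.
- move=> s /andP[s0 st]; rewrite ltNge; apply/negP => ds.
  have /tmin : s \in A.
    rewrite inE; split; last by left.
    by rewrite /= s0 (le_trans (ltW st)) //; case/andP: th.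
  by rewrite leNgt st.
- by case: tA => [//|->]; rewrite ltxx.
Qed.

(** The path is the limit of its values at the times k/(n+1) just before s, which
    are jointly measurable in time and chance.  Hence a process may be evaluated
    at a random time, and Tonelli's theorem applies to its time integrals. *)
Lemma measurable_fun_path d (T : measurableType d) (f : R -> T -> R) :
  (forall w, continuous (f ^~ w)) ->
  (forall s, 0 <= s -> measurable_fun [set: T] (f s)) ->
  measurable_fun [set: R * T] (fun p => f (Num.max p.1 0) p.2).
Proof.
move=> cf mf.
pose g (n : nat) (x : R) : R := (Num.truncn (n.+1%:R * Num.max x 0))%:R / n.+1%:R.
apply: (@measurable_fun_cvg _ _ _ _ (fun n (p : R * T) => f (g n p.1) p.2)).
- move=> n _ C mC; rewrite setTI.
  pose D k := [set x : R | Num.truncn (n.+1%:R * Num.max x 0) = k].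
  rewrite (_ : _ @^-1` _ = \bigcup_k (D k `*` (f (k%:R / n.+1%:R) @^-1` C)));
    last first.
    apply/seteqP; split => [[x w] /= Cx|[x w] /= [k _] [/= Dk Ck]];
      last by rewrite /g Dk.
    by exists (Num.truncn (n.+1%:R * Num.max x 0)).
  apply: bigcupT_measurable => k; apply: measurableX.
  + rewrite (_ : D k = (fun x : R => n.+1%:R * Num.max x 0) @^-1` `[k%:R,
    k.+1%:R[%classic).
      have mm : measurable_fun [set: R] (fun x : R => n.+1%:R * Num.max x 0).
        by apply: measurable_funM => //; exact: measurable_maxr.
      by rewrite -[X in measurable X]setTI; apply: mm => //; exact: measurable_itv.
    apply/seteqP; split => x; rewrite /D /= in_itv /=.
      by move=> <-; apply: truncn_itv; rewrite mulr_ge0 // le_max lexx orbT.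
    exact: truncn_def.
  + have kn : 0 <= k%:R / n.+1%:R :> R by rewrite divr_ge0.
    by have := mf _ kn measurableT C mC; rewrite setTI.
- move=> [x w] _ /=.
  set y := Num.max x 0.
  suff gy : g n x @[n --> \oo] --> y by exact: (cvg_comp _ _ gy (cf w y)).
  have y0 : 0 <= y by rewrite le_max lexx orbT.
  have g_itv n : y - n.+1%:R^-1 <= g n x <= y.
    have n0 : 0 < n.+1%:R :> R by [].
    have /andP[] : (Num.truncn (n.+1%:R * y))%:R <= n.+1%:R * y < (Num.truncn
      (n.+1%:R * y)).+1%:R.
      by apply: truncn_itv; rewrite mulr_ge0.
    rewrite -[(Num.truncn _).+1%:R]natr1 /g -/y; move: (Num.truncn _)%:R => k k1 k2.
    have e : n.+1%:R * (y - n.+1%:R^-1) = n.+1%:R * y - 1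
      by rewrite mulrBr mulfV // gt_eqF.
    apply/andP; split; last by rewrite ler_pdivrMr // mulrC.
    by rewrite ler_pdivlMr // mulrC e lerBlDr ltW.
  apply: (@squeeze_cvgr _ _ _ _ (fun n => y - n.+1%:R^-1) (cst y)); last exact: cvg_cst.
    by apply: nearW => n; exact: g_itv.
  rewrite -[X in _ --> X]subr0; apply: cvgB; first exact: cvg_cst.
  exact: cvg_harmonic.
Qed.

End paths.

(** * Exit time of the diffusion from a small interval *)

Section exit_time.
Context d (Omega : measurableType d) (R : realType) (P : probability Omega R).
Hypothesis P_complete : measure_is_complete P.
Variable B : R -> Omega -> R.
Hypothesis BM : brownian_motion P B.
Notation F := (augmented_filtration P B).
Notation info := (information P B).

Variables (I : set R) (sigma : R -> R) (x0 : R) (Y : R -> Omega -> R).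
Hypothesis I_open : open I.
Hypothesis sigma_cont : {within I, continuous sigma}.
Hypothesis sol : sde_solution P I sigma B x0 Y.

(** Extended by its initial value to negative times, so as to have continuous
    paths on the whole line. *)
Definition displacement (s : R) (w : Omega) : R := Y (Num.max s 0) w - x0.

Lemma displacementE s w : 0 <= s -> displacement s w = Y s w - x0.
Proof. by move=> s0; rewrite /displacement max_l. Qed.

Lemma displacement_continuous w : continuous (displacement ^~ w).
Proof.
move=> s; apply: cvgB; last exact: cvg_cst.
by have cY : continuous_paths Y := sol_continuous sol; exact: (continuous_clamp (cY w)).
Qed.

Lemma displacement_measurable s t : 0 <= s -> s <= t ->
  measurable_fun [set: info t] (displacement s : info t -> R).
Proof.
move=> s0 st; apply: (information_le st).
apply: measurable_funB; last exact: measurable_cst.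
rewrite max_l // => _ C mC; rewrite setTI; exact: (sol_adapted sol).
Qed.

Variables (dl h : R).
Hypothesis h_ge0 : 0 <= h.

Definition exit_time (w : Omega) : R :=
  projT1 (cid (exists_hitting_time dl h_ge0 (@displacement_continuous w))).

Lemma exit_timeP w : [/\ 0 <= exit_time w <= h,
  (forall s, 0 <= s < exit_time w -> `|displacement s w| < dl) &
  exit_time w < h -> dl <= `|displacement (exit_time w) w|].
Proof. exact: (projT2 (cid (exists_hitting_time dl h_ge0 (@displacement_continuous
  w)))). Qed.

Lemma exit_time_ge0 w : 0 <= exit_time w.
Proof. by have [/andP[]] := exit_timeP w. Qed.

Lemma exit_time_le w : exit_time w <= h.
Proof. by have [/andP[]] := exit_timeP w. Qed.

Lemma exit_time_stopping : stopping_time F exit_time.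
Proof.
split=> [w|t t0]; first exact: exit_time_ge0.
have [ht|th] := leP h t.
  rewrite (_ : [set _ | _] = setT); last first.
    by apply/seteqP; split => // w _; exact: le_trans (exit_time_le w) ht.
  exact: (@measurableT _ (info t)).
rewrite (_ : [set _ | _] = [set w | exists2 s,
  0 <= s <= t & dl <= `|displacement s w|]).
  apply: (@measurable_exists_ge _ _ (info t) (fun s w => `|displacement s w|)) => //.
  - by move=> w s; apply: cvg_norm; exact: displacement_continuous.
  - by move=> s /andP[s0 st]; apply: measurableT_comp => //;
    exact: displacement_measurable.
apply/seteqP; split => w /=; have [th0 hit ex] := exit_timeP w.
  move=> tt; exists (exit_time w); first by rewrite exit_time_ge0.
  by apply: ex; exact: le_lt_trans th.
case=> s /andP[s0 st] ds; rewrite leNgt; apply/negP => tt.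
by have := hit s; rewrite s0 (le_lt_trans st tt) => /(_ isT); rewrite ltNge ds.
Qed.

Lemma exit_time_measurable : measurable_fun [set: Omega] exit_time.
Proof.
move=> mD; apply: (measurability _ (RGenOInfty.measurableE R)) => //.
move=> _ [_ [x ->] <-]; rewrite setTI.
have [x0'|x0'] := ltP x 0.
  rewrite (_ : _ @^-1` _ = setT) //; apply/seteqP; split => // w _ /=.
  by rewrite in_itv /= andbT (lt_le_trans x0') // exit_time_ge0.
rewrite (_ : _ @^-1` _ = ~` [set w | exit_time w <= x]).
  apply: measurableC; apply: (augmented_filtration_measurable P_complete BM).
  by have [_] := exit_time_stopping; apply.
by apply/seteqP; split => w /=; rewrite in_itv /= andbT ltNge => /negP.
Qed.

Lemma displacement_before_exit w s : `|displacement 0 w| < dl ->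
  0 <= s <= exit_time w -> `|displacement s w| <= dl.
Proof.
move=> d0 /andP[s0]; rewrite le_eqVlt => /predU1P[->|st]; last first.
  by have [_ hit _] := exit_timeP w; apply/ltW/hit; rewrite s0.
have := exit_time_ge0 w; rewrite le_eqVlt => /predU1P[<-|t0]; first exact: ltW.
rewrite leNgt; apply/negP => dt.
have cn : {for exit_time w, continuous (fun s => `|displacement s w|)}.
  by apply: cvg_norm; exact: displacement_continuous.
have : \forall s \near (exit_time w)^'-, dl < `|displacement s w|.
  by apply: (cvgr_gt _ (cvg_at_left_filter cn)).
move=> H; have : \forall s \near (exit_time w)^'-, False.
  near=> s'.
  have s'0 : 0 < s' by near: s'; apply: nbhs_left_gt.
  have s't : s' < exit_time w by near: s'; exact: nbhs_left_lt.
  have [_ hit _] := exit_timeP w.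
  have /ltW := hit s' ltac:(by rewrite (ltW s'0) s't).
  by rewrite leNgt => /negP; apply; near: s'.
by move/filter_ex => -[].
Unshelve. all: end_near. Qed.

Lemma displacement_after_exit_measurable u : 0 <= u ->
  measurable_fun [set: Omega] (fun w => displacement (exit_time w + u) w).
Proof.
move=> u0.
have mp : measurable_fun [set: R * Omega] (fun p => displacement (Num.max p.1 0) p.2).
  apply: (measurable_fun_path (f := displacement));
    first exact: displacement_continuous.
  by move=> s s0; apply: (information_sub P_complete BM);
    exact: (displacement_measurable s0 (lexx s)).
have mt : measurable_fun [set: Omega] (fun w => (exit_time w + u, w)).
  by apply: measurable_fun_pair => //; apply: measurable_funD => //;
    exact: exit_time_measurable.
have := measurableT_comp mp mt; apply: eq_measurable_fun => w _ /=.
by rewrite max_l // addr_ge0 // exit_time_ge0.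
Qed.

Lemma displacement0_ae : {ae P, forall w, displacement 0 w = 0}.
Proof.
apply: filterS (sol_start sol) => w Yw.
by rewrite displacementE // Yw subrr.
Qed.

Lemma exit_time_gt0 w : 0 < dl -> 0 < h -> displacement 0 w = 0 -> 0 < exit_time w.
Proof.
move=> dl0 h0 d0; rewrite lt_neqAle exit_time_ge0 andbT eq_sym; apply/eqP => t0.
have [_ _] := exit_timeP w; rewrite t0 => /(_ h0); rewrite d0 normr0.
by rewrite leNgt dl0.
Qed.

Lemma sigma_path_measurable :
  measurable_fun [set: R * Omega] (fun p => sigma (Y (Num.max p.1 0) p.2)).
Proof.
have cI y : I y -> {for y, continuous sigma}.
  move=> Iy; have := sigma_cont; rewrite continuous_open_subspace // => /(_ y).
  by rewrite inE => /(_ Iy).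
apply: (eq_measurable_fun (fun p : R * Omega =>
  sigma (Y (Num.max (Num.max p.1 0) 0) p.2))).
  by move=> p _; rewrite (@max_l _ _ (Num.max p.1 0)) // le_max lexx orbT.
apply: (@measurable_fun_path _ _ _ (fun s w => sigma (Y (Num.max s 0) w))).
- move=> w s; have cY : continuous_paths Y := sol_continuous sol.
  have cp := continuous_clamp (cY w) (x := s).
  apply: (continuous_comp cp); apply: cI; apply: (sol_state sol).
  by rewrite le_max lexx orbT.
- move=> s s0; rewrite max_l //.
  have mI : measurable I by exact: open_measurable.
  have msig : measurable_fun I sigma.
    by apply: open_continuous_measurable_fun => // y; rewrite inE => Iy;
      exact: (cI y Iy).
  apply: (measurable_comp mI _ msig); first by move=> _ [w _ <-];
    exact: (sol_state sol).
  apply: (information_sub P_complete BM (t := s)) => _ C mC; rewrite setTI.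
  exact: (sol_adapted sol).
Qed.

End exit_time.

(** * Ito approximation of the displacement at the exit time *)

Section ito_errors.
Context d (Omega : measurableType d) (R : realType) (P : probability Omega R).
Hypothesis P_complete : measure_is_complete P.
Variable B : R -> Omega -> R.
Hypothesis BM : brownian_motion P B.
Notation F := (augmented_filtration P B).
Notation info := (information P B).

Variables (I : set R) (sigma : R -> R) (x0 : R) (Y : R -> Omega -> R).
Hypothesis I_open : open I.
Hypothesis sigma_cont : {within I, continuous sigma}.
Hypothesis sol : sde_solution P I sigma B x0 Y.
Variables (H : simple_process Omega R) (h : R).
Hypothesis H_simple : is_simple F H.
Hypothesis h_ge0 : 0 <= h.

Let sp_coef_measurable (k : 'I_(sp_size H)) : measurable_fun [set: Omega] (sp_coef H k).
Proof.
apply: (information_sub P_complete BM (t := sp_time H k)) => _ C mC; rewrite setTI.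
by have [_ _ Hc] := H_simple; have [_] := Hc k (ltn_ord k); exact.
Qed.

(** The two families of events in the definition of the stochastic integral have
    to be measurable for their probabilities to be meaningful. *)
Lemma l2_error_measurable (e : R) : measurable
  [set w | (e%:E < \int[lebesgue_measure]_(s in `[0%R, h])
                      ((sp_value H s w - sigma (Y s w)) ^+ 2)%:E)%E].
Proof.
pose f (p : Omega * R) : \bar R :=
  (((sp_value H p.2 p.1 - sigma (Y (Num.max p.2 0) p.1)) ^+ 2) *
    \1_(`[0, h]%classic) p.2)%:E.
have mf : measurable_fun [set: Omega * R] f.
  apply/measurable_EFinP; apply: measurable_funM; last first.
    by apply: measurableT_comp => //; apply: measurable_indic; exact: measurable_itv.
  apply: measurable_funX; apply: measurable_funB.
  - apply: measurable_sum => k; apply: measurable_funM.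
      exact: measurableT_comp.
    by apply: measurableT_comp => //; apply: measurable_indic; exact: measurable_itv.
  - have msw : measurable_fun [set: Omega * R] (fun p => (p.2,
    p.1)) by exact: measurable_fun_pair.
    exact: (measurableT_comp (sigma_path_measurable P_complete BM I_open sigma_cont
      sol) msw).
have mf' : measurable_fun [set: Omega * measurableTypeR R] f := mf.
have f0 z : (0 <= f z)%E by rewrite lee_fin mulr_ge0 ?sqr_ge0 // indicE.
have mF := @measurable_fun_fubini_tonelli_F _ _ Omega (measurableTypeR R) R
  lebesgue_measure f mf' f0.
have := mF measurableT _ (emeasurable_itv `]e%:E, +oo[%O).
rewrite setTI; congr measurable.
rewrite (_ : fubini_F _ _ = (fun w => \int[lebesgue_measure]_(s in `[0%R, h])
                      ((sp_value H s w - sigma (Y s w)) ^+ 2)%:E)%E).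
  by apply/seteqP; split => w /=; rewrite in_itv /= andbT.
apply/funext => w; rewrite /fubini_F [RHS]integral_mkcond.
apply: eq_integral => s _; rewrite /f /= patchE indicE.
case: ifPn => [|_]; last by rewrite mulr0.
by rewrite inE /= in_itv /= => /andP[s0 sh]; rewrite mulr1 max_l.
Qed.

Lemma sp_integral_continuous w : continuous (fun s : R =>
  sp_integral B H (Num.max s 0) w).
Proof.
have time_ge0 k : 0 <= sp_time H k.
  by have [t0 tm _] := H_simple; apply: le_trans t0 (tm _ _ (leq0n k)).
have cB k : continuous (fun s : R => B (Num.min (sp_time H k) (Num.max s 0)) w).
  have cpB : continuous_paths B := bm_continuous BM.
  have cc := continuous_clamp (cpB w).
  move=> s; rewrite (_ : (fun s : R => _) = (fun s =>
    B (Num.max (Num.min (sp_time H k) s) 0) w)).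
    have cmin : {for s, continuous (fun s : R => Num.min (sp_time H k) s)}.
      exact: (continuous_min (@cst_continuous R R (sp_time H k) s) (@cvg_id _ _)).
    exact: (continuous_comp cmin (cc _)).
  apply/funext => y /=; congr B; have tk := time_ge0 k.
  have [y0|y0] := leP 0 y; first by rewrite max_l // le_min tk.
  by rewrite (min_r (le_trans (ltW y0) tk)) max_r ?ltW // min_r.
rewrite /sp_integral; apply: (continuous_big (@add_continuous R)) => k _ s.
apply: cvgM; first exact: cvg_cst.
by apply: cvgB; exact: cB.
Qed.

Lemma sup_error_measurable (e : R) : measurable
  [set w | exists2 s, 0 <= s <= h & e < `|sp_integral B H s w - (Y s w - x0)|].
Proof.
have := @measurable_exists_gt R d Omega
  (fun s w => `|sp_integral B H (Num.max s 0) w - displacement x0 Y s w|) h e h_ge0.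
have -> : [set w | exists2 s, 0 <= s <= h &
    e < `|sp_integral B H (Num.max s 0) w - displacement x0 Y s w|] =
  [set w | exists2 s, 0 <= s <= h & e < `|sp_integral B H s w - (Y s w - x0)|].
  by apply/seteqP; split => w /= -[s sh es]; exists s => //; move: es;
    have /andP[s0 _] := sh; rewrite displacementE // max_l.
apply.
- move=> w s; apply: cvg_norm; apply: cvgB; first exact: sp_integral_continuous.
  exact: (displacement_continuous sol).
- move=> s /andP[s0 _]; apply: measurableT_comp => //; apply: measurable_funB;
  last first.
    by apply: (information_sub P_complete BM);
      exact: (displacement_measurable sol s0 (lexx s)).
  rewrite max_l // /sp_integral; apply: measurable_sum => k.
  have time_ge0 j : 0 <= sp_time H j.
    by have [t0 tm _] := H_simple; apply: le_trans t0 (tm _ _ (leq0n j)).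
  apply: measurable_funM => //.
  by apply: measurable_funB; apply: (bm_measurable BM); rewrite le_min s0 time_ge0.
Qed.

End ito_errors.

(** Add the multiples of mesh below h to the jump times. *)
Lemma exists_fine_grid d (Omega : measurableType d) (R : realType)
    (H : simple_process Omega R) (h mesh : R) : 0 <= h -> 0 < mesh ->
  (forall k, 0 <= sp_time H k) ->
  exists (c : nat -> R) (N : nat),
    [/\ c 0%N = 0, c N = h, (forall k, c k <= c k.+1 /\ c k <= h),
      (forall k, c k.+1 - c k <= mesh) & forall k, off_times H (c k) (c k.+1)].
Proof.
move=> h0 mesh0 time_ge0.
pose L := (Num.truncn (h / mesh)).+2.
pose s0 := [seq Num.min (sp_time H j) h | j <- iota 0 (sp_size H).+1] ++
           [seq Num.min (i%:R * mesh) h | i <- iota 0 L].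
have [x|c [N [c0 cN c_homo ch coff]]] := @exists_grid R s0 h h0.
  rewrite mem_cat => /orP[] /mapP[j _ ->]; rewrite le_min ge_min lexx orbT h0 !andbT.
    exact: time_ge0.
  by rewrite mulr_ge0 // ltW.
have c_ge0 k : 0 <= c k by elim: k => [|k]; [rewrite c0|move/le_trans; apply].
exists c, N; split => // k.
- rewrite leNgt; apply/negP => big.
  pose i := (Num.truncn (c k / mesh)).+1.
  have /andP[i1 i2] : (Num.truncn (c k / mesh))%:R <= c k / mesh < i%:R.
    by apply: truncn_itv; rewrite divr_ge0 // ltW.
  have im1 : c k < i%:R * mesh by rewrite -ltr_pdivrMr.
  have im2 : i%:R * mesh < c k.+1.
    move: i1; rewrite ler_pdivlMr // => i1.
    by rewrite /i -natr1 mulrDl mul1r; lra.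
  apply: (coff k (i%:R * mesh)); last by rewrite im1.
  rewrite mem_cat; apply/orP; right; apply/mapP; exists i.
    rewrite mem_iota add0n /= /L /i ltnS ltnS; apply: le_truncn.
    by apply: ler_wpM2r; [rewrite invr_ge0 ltW|exact: ch].
  by rewrite min_l // (le_trans (ltW im2)) // ch.
- move=> j jn /andP[cj jc]; apply: (coff k (sp_time H j)); last by rewrite cj.
  rewrite mem_cat; apply/orP; left; apply/mapP; exists j; first by rewrite mem_iota.
  by rewrite min_l // (le_trans (ltW jc)) // ch.
Qed.

(** A single path w is fixed, on which H approximates sigma(Y), the integral of H
    approximates Y - x0, and Y does not move by more than e within a time mesh
    after tau. *)
Section pathwise.
Context d (Omega : measurableType d) (R : realType) (P : probability Omega R).
Variable B : R -> Omega -> R.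
Notation F := (augmented_filtration P B).

Variables (I : set R) (sigma : R -> R) (x0 : R) (Y : R -> Omega -> R).
Hypothesis sol : sde_solution P I sigma B x0 Y.
Variables (dl h m : R).
Hypothesis h_ge0 : 0 <= h.
Hypothesis sigma_ge : forall y, `|y - x0| <= 2 * dl -> m <= sigma y ^+ 2.
Hypothesis m_ge0 : 0 <= m.

Notation disp := (displacement x0 Y).
Notation tau := (exit_time sol dl h_ge0).

Variables (H : simple_process Omega R) (c : nat -> R) (N : nat) (mesh e : R).
Hypothesis H_simple : is_simple F H.
Hypothesis c0 : c 0%N = 0.
Hypothesis cN : c N = h.
Hypothesis c_homo : forall k, c k <= c k.+1.
Hypothesis c_le : forall k, c k <= h.
Hypothesis c_mesh : forall k, c k.+1 - c k <= mesh.
Hypothesis c_off : forall k, off_times H (c k) (c k.+1).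
Hypothesis mesh_ge0 : 0 <= mesh.
Hypothesis e_lt : e < dl.
Hypothesis e_ge0 : 0 <= e.

Notation S := (stopped_sum B c (grid_coef H c) tau (2 * dl)).
Notation V := (stopped_bracket B c (grid_coef H c) tau (2 * dl)).

Variable w : Omega.
Hypothesis volatility_measurable :
  measurable_fun [set: R] (fun s => sigma (Y (Num.max s 0) w)).
Hypothesis start : `|disp 0 w| < dl.
Hypothesis sup_error :
  forall s, 0 <= s <= h -> `|sp_integral B H s w - disp s w| <= e.
Hypothesis l2_error :
  (\int[lebesgue_measure]_(s in `[0%R, h])
    ((sp_value H s w - sigma (Y s w)) ^+ 2)%:E <= e%:E)%E.
Hypothesis oscillation :
  forall u, 0 <= u <= mesh -> `|disp (tau w + u) w - disp (tau w) w| <= e.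

Let c_ge0 k : 0 <= c k.
Proof. by elim: k => [|k]; [rewrite c0|move/le_trans; apply]. Qed.

(** Before tau the path stays within dl of x0, so the integral of H stays within
    dl + e < 2 dl of zero, and the sum is not frozen prematurely. *)
Lemma stopped_sum_before_exit k : (forall j, (j < k)%N -> c j < tau w) ->
  S k w = sp_integral B H (c k) w /\
  V k w = \sum_(j < k) grid_coef H c j w ^+ 2 * (c j.+1 - c j).
Proof.
elim: k => [|k IH] ck.
  by rewrite /stopped_bracket !big_ord0 c0 (sp_integral0 H_simple).
have [Sk Vk] := IH (fun j jk => ck j (ltnW jk)).
have act : stopped_coef B c (grid_coef H c) tau (2 * dl) k w = grid_coef H c k w.
  rewrite /stopped_coef /active ck // Sk ifT //.
  have : `|sp_integral B H (c k) w - disp (c k) w| <= e by apply: sup_error;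
    rewrite c_ge0 c_le.
  have : `|disp (c k) w| <= dl.
    have ktau : 0 <= c k <= tau w by rewrite c_ge0 /= ltW // ck.
    exact: displacement_before_exit start ktau.
  have := ler_normD (sp_integral B H (c k) w - disp (c k) w) (disp (c k) w).
  rewrite subrK; move: e_lt; lra.
split.
  by rewrite stopped_sumS act Sk (sp_integral_gridS H_simple).
by move: Vk; rewrite /stopped_bracket !big_ord_recr /= => ->; rewrite act.
Qed.

Lemma stopped_sum_frozen K : tau w <= c K -> forall j,
  S (K + j)%N w = S K w /\ V (K + j)%N w = V K w.
Proof.
move=> tK; elim=> [|j [Sj Vj]]; first by rewrite addn0.
have cKj : c K <= c (K + j)%N.
  by elim: (j) => [|i /le_trans]; [rewrite addn0|rewrite addnS; apply].
have inact : stopped_coef B c (grid_coef H c) tau (2 * dl) (K + j)%N w = 0.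
  by rewrite /stopped_coef /active ltNge (le_trans tK cKj).
rewrite addnS stopped_sumS inact mul0r addr0; split => //.
by move: Vj; rewrite /stopped_bracket big_ord_recr /= inact expr0n mul0r addr0.
Qed.

(** The sum freezes at the first grid time c_K after tau, which is within mesh of
    tau.  Its bracket is the integral of H^2 over [0, c_K], and
    H^2 >= sigma^2 / 2 - (H - sigma)^2, where sigma^2 >= m as the path is still
    within 2 dl of x0. *)
Lemma stopped_sum_approx :
  `|S N w - disp (tau w) w| <= 2 * e /\ m / 2 * tau w - e <= V N w.
Proof.
have exK : exists k, tau w <= c k by exists N; rewrite cN exit_time_le.
(* index of the first grid time after tau *)
pose K := ex_minn exK.
have [tK minK] : tau w <= c K /\ forall k, tau w <= c k -> (K <= k)%N.
  by rewrite /K; case: ex_minnP.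
have beforeK j : (j < K)%N -> c j < tau w.
  by move=> jK; rewrite ltNge; apply/negP => /minK; rewrite leqNgt jK.
have KN : (K <= N)%N by apply: minK; rewrite cN exit_time_le.
have [SK VK] := stopped_sum_before_exit beforeK.
have [SN VN] := stopped_sum_frozen tK (N - K)%N.
rewrite subnKC // in SN VN.
have t0 : 0 <= tau w by exact: exit_time_ge0.
have u_itv : 0 <= c K - tau w <= mesh.
  rewrite subr_ge0 tK /=; case: (K) tK beforeK => [|k] tk before.
    by rewrite c0 lerBlDr; apply: le_trans mesh_ge0 _; rewrite lerDl.
  have := c_mesh k; have := before k (ltnSn k); lra.
have osc := oscillation u_itv; rewrite subrKC in osc.
have supK : `|sp_integral B H (c K) w - disp (c K) w| <= e by apply: sup_error;
  rewrite c_ge0 c_le.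
split.
  rewrite SN SK.
  have := ler_normD (sp_integral B H (c K) w - disp (c K) w) (disp (c K) w - disp
    (tau w) w).
  by rewrite addrA subrK; lra.
rewrite VN VK.
have near_x0 s : 0 <= s <= c K -> m <= sigma (Y s w) ^+ 2.
  move=> /andP[s0 sK]; apply: sigma_ge; rewrite -displacementE //.
  have tautau : 0 <= tau w <= tau w by rewrite t0 lexx.
  have dtau := displacement_before_exit start tautau.
  have [st|ts] := leP s (tau w).
    have stau : 0 <= s <= tau w by rewrite s0.
    have := displacement_before_exit start stau.
    move: e_lt e_ge0; lra.
  have : `|disp s w - disp (tau w) w| <= e.
    rewrite -{1}(subrKC (tau w) s) oscillation // subr_ge0 ltW //=.
    by move: u_itv => /andP[_]; apply: le_trans; rewrite lerB.
  have := ler_normD (disp s w - disp (tau w) w) (disp (tau w) w).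
  rewrite subrK; move: e_lt; lra.
pose err (s : R) : R := (sp_value H s w - sigma (Y s w)) ^+ 2.
have merr (b : R) : measurable_fun (`[0, b]%classic : set R) (fun s : R => (err s)%:E).
  apply/measurable_EFinP; apply: measurable_funX; apply: measurable_funB.
    by apply: measurable_funTS; exact: sp_value_measurable_time.
  have : measurable_fun (`[0,
    b]%classic : set R) (fun s : R => sigma (Y (Num.max s 0) w)).
    exact: measurable_funTS volatility_measurable.
  apply: eq_measurable_fun => s; rewrite inE /= in_itv /= => /andP[s0 _].
  by rewrite max_l.
have msp (b : R) : measurable_fun (`[0,
  b]%classic : set R) (fun s : R => (sp_value H s w ^+ 2)%:E).
  apply/measurable_EFinP/measurable_funTS.
  by apply: measurable_funX; exact: sp_value_measurable_time.
have err_le : (\int[lebesgue_measure]_(s in `[0%R, c K]) (err s)%:E <= e%:E)%E.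
  apply: le_trans l2_error; apply: ge0_subset_integral => //.
  - exact: merr.
  - by move=> s _; rewrite lee_fin sqr_ge0.
  - move=> s /=; rewrite !in_itv /= => /andP[-> /=] /le_trans; apply; exact: c_le.
have split_int : (\int[lebesgue_measure]_(s in `[0%R,
  c K]) (err s + sp_value H s w ^+ 2)%:E =
    \int[lebesgue_measure]_(s in `[0%R, c K]) (err s)%:E +
    \int[lebesgue_measure]_(s in `[0%R, c K]) (sp_value H s w ^+ 2)%:E)%E.
  under eq_integral do rewrite EFinD.
  rewrite ge0_integralD //.
  - by move=> s _; rewrite lee_fin sqr_ge0.
  - exact: merr.
  - by move=> s _; rewrite lee_fin sqr_ge0.
  - exact: msp.
have low : ((m / 2 * c K)%:E <=
    \int[lebesgue_measure]_(s in `[0%R, c K]) (err s + sp_value H s w ^+ 2)%:E)%E.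
  apply: (@le_trans _ _ (\int[lebesgue_measure]_(s in `[0%R, c K]) (m / 2)%:E)%E).
    have len : lebesgue_measure (`[0, c K]%classic : set R) = (c K)%:E.
      rewrite lebesgue_measure_itv /= lte_fin; case: ltP => [_|cK];
        first by rewrite sube0.
      by congr EFin; apply/eqP; rewrite eq_le cK c_ge0.
    by rewrite integral_cst // [X in (_ * X)%E]len EFinM.
  apply: ge0_le_integral.
  - exact: measurable_itv.
  - by move=> s _; rewrite lee_fin divr_ge0.
  - exact: measurable_cst.
  - exact: (emeasurable_funD (merr (c K)) (msp (c K))).
  - move=> s /=; rewrite in_itv /= => /near_x0 ms; rewrite lee_fin /err.
    have := sqr_ge0 (2 * sp_value H s w - sigma (Y s w)); nra.
move: low; rewrite split_int (integral_sp_value_sqr c0 c_homo c_off).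
have : (0 <= \int[lebesgue_measure]_(s in `[0%R, c K]) (err s)%:E)%E.
  by apply: integral_ge0 => s _; rewrite lee_fin sqr_ge0.
move: err_le; case: (\int[lebesgue_measure]_(s in `[0%R,
  c K]) (err s)%:E)%E => [q| |] //.
rewrite -?EFinD !lee_fin => qe _ low.
have : m / 2 * tau w <= m / 2 * c K by rewrite ler_wpM2l // divr_ge0.
lra.
Qed.
End pathwise.

Section limit_moments.
Context d (Omega : measurableType d) (R : realType) (P : probability Omega R).

(** The approximants S have mean zero and satisfy an isometry inequality with
    bracket V; they are close to W outside a small event, and Q controls their
    values beyond 4 dl, so that nothing is lost on that event. *)
Lemma approximable_moments (W tau : Omega -> R) (dl h m : R) :
  0 < dl -> 0 <= h -> 0 <= m ->
  measurable_fun [set: Omega] W -> (forall w, `|W w| <= dl) ->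
  measurable_fun [set: Omega] tau -> (forall w, 0 <= tau w <= h) ->
  (forall eps, 0 < eps -> exists (S V Q : Omega -> R) (G : set Omega),
    [/\ P.-integrable [set: Omega] (EFin \o S) /\ \int[P]_w S w = 0,
      P.-integrable [set: Omega] (EFin \o (fun w => S w ^+ 2)) /\
        P.-integrable [set: Omega] (EFin \o V) /\
        \int[P]_w V w <= 8 * \int[P]_w (S w ^+ 2),
      P.-integrable [set: Omega] (EFin \o Q) /\ \int[P]_w Q w <= eps,
      measurable G /\ (P (~` G) <= eps%:E)%E &
      (forall w, [/\ 0 <= V w, 0 <= Q w & `|S w| <= 4 * dl \/ S w ^+ 2 <= Q w]) /\
      (forall w, G w -> `|S w - W w| <= eps /\ m / 2 * tau w - eps <= V w)]) ->
  \int[P]_w W w = 0 /\ m / 16 * \int[P]_w tau w <= \int[P]_w (W w ^+ 2).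
Proof.
move=> dl0 h0 m0 mW W_le mtau tau_itv approx.
have iW : P.-integrable [set: Omega] (EFin \o W) by exact: bounded_integrable mW W_le.
have iW2 : P.-integrable [set: Omega] (EFin \o (fun w => W w ^+ 2)).
  apply: (@bounded_integrable _ _ _ _ _ (dl ^+ 2)); first exact: measurable_funX.
  by move=> w; rewrite normrX lerXn2r ?nnegrE ?(ltW dl0).
have itau : P.-integrable [set: Omega] (EFin \o tau).
  apply: (@bounded_integrable _ _ _ _ _ h) => // w.
  by have /andP[t0 th] := tau_itv w; rewrite ger0_norm.
have icst k : P.-integrable [set: Omega] (EFin \o (fun=> k : R)).
  exact: finite_measure_integrable_cst.
have Ecst k : \int[P]_w k = k :> R.
  have P1 : fine (P [set: Omega]) = 1 by rewrite probability_setT.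
  by rewrite Rintegral_cst // [X in _ * X]P1 mulr1.
have iG G : measurable G -> P.-integrable [set: Omega] (EFin \o (\1_(~` G) : Omega ->
  R)).
  by move=> mG; apply: integrable_indic => //; exact: measurableC.
have EG G eps : measurable G -> (P (~` G) <= eps%:E)%E -> \int[P]_w (\1_(~` G) w : R)
  <= eps.
  move=> mG Ge; rewrite /Rintegral integral_indic //; last exact: measurableC.
  rewrite setIT -lee_fin fineK // fin_num_measure //; exact: measurableC.
have iZ k (f : Omega -> R) : P.-integrable [set: Omega] (EFin \o f) ->
    P.-integrable [set: Omega] (EFin \o (fun w => k * f w)).
  by move=> i; exact: (integrableZl measurableT k i).
have iD (f g : Omega -> R) : P.-integrable [set: Omega] (EFin \o f) ->
    P.-integrable [set: Omega] (EFin \o g) ->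
    P.-integrable [set: Omega] (EFin \o (fun w => f w + g w)).
  by move=> i j; exact: (integrableD measurableT i j).
have EZ k (f : Omega -> R) : P.-integrable [set: Omega] (EFin \o f) ->
    \int[P]_w (k * f w) = k * \int[P]_w f w.
  by move=> i; rewrite RintegralZl.
have ED (f g : Omega -> R) : P.-integrable [set: Omega] (EFin \o f) ->
    P.-integrable [set: Omega] (EFin \o g) ->
    \int[P]_w (f w + g w) = \int[P]_w f w + \int[P]_w g w.
  by move=> i j; rewrite RintegralD.
split.
- suff small eps : 0 < eps -> `|\int[P]_w W w| <= (1 + 5 * dl + (4 * dl)^-1) * eps.
    apply/eqP; rewrite -normr_eq0 eq_le normr_ge0 andbT.
    apply/ler_addgt0Pl => e e0; rewrite addr0.
    set k := 1 + 5 * dl + (4 * dl)^-1 in small.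
    have k0 : 0 < k by rewrite /k !addr_gt0 ?mulr_gt0 ?invr_gt0 ?mulr_gt0.
    by have := small (e / k) (divr_gt0 e0 k0); rewrite mulrC divfK // gt_eqF.
  move=> eps0; have [S [V [Q [G [[iS ES] [iS2 [iV EV]] [iQ EQ] [mG PG] [SVQ SW]]]]]]
    := approx eps eps0.
  have iSW := iD _ _ iS (iZ (-1) _ iW).
  have <- : \int[P]_w (W w + -1 * S w) = \int[P]_w W w.
    by rewrite (ED _ _ iW (iZ (-1) _ iS)) (EZ _ _ iS) ES mulr0 addr0.
  have iWS := iD _ _ iW (iZ (-1) _ iS).
  apply: le_trans (le_normr_Rintegral measurableT iWS) _.
  pose bound w := eps + 5 * dl * \1_(~` G) w + (4 * dl)^-1 * Q w.
  have ib1 := iD _ _ (icst eps) (iZ (5 * dl) _ (iG _ mG)).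
  have ibound : P.-integrable [set: Omega] (EFin \o bound) :=
    iD _ _ ib1 (iZ (4 * dl)^-1 _ iQ).
  apply: (@le_trans _ _ (\int[P]_w bound w)).
    apply: le_Rintegral => //; first exact: (integrable_norm iWS).
    move=> w _; have [V0 Q0 SQ] := SVQ w; rewrite /bound mulN1r.
    have q0 : 0 <= (4 * dl)^-1 * Q w by rewrite mulr_ge0 // invr_ge0 mulr_ge0 // ltW.
    have [Gw|nGw] := pselect (G w).
      have [+ _] := SW w Gw; rewrite distrC indicE memNset; last by apply.
      by rewrite mulr0 addr0; move=> /le_trans; apply; rewrite lerDl.
    rewrite indicE mem_set // mulr1.
    apply: le_trans (ler_normB _ _) _; have := W_le w.
    have : `|S w| <= 4 * dl + (4 * dl)^-1 * Q w.
      case: SQ => SQ; first by rewrite (le_trans SQ) // lerDl.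
      have [Sd|Sd] := leP `|S w| (4 * dl); first by rewrite (le_trans Sd) // lerDl.
      apply: le_trans (_ : (4 * dl)^-1 * Q w <= _);
        last by rewrite lerDr mulr_ge0 // ltW.
      rewrite ler_pdivlMl ?mulr_gt0 //; apply: le_trans SQ.
      by rewrite -[S w ^+ 2]real_normK ?num_real // expr2 ler_wpM2r // ltW.
    move: ((4 * dl)^-1 * Q w) q0 eps0; clear=> *; lra.
  rewrite (ED _ _ ib1 (iZ (4 * dl)^-1 _ iQ)) (ED _ _ (icst eps) (iZ (5 * dl) _ (iG _
    mG))).
  rewrite (EZ _ _ iQ) (EZ _ _ (iG _ mG)) Ecst.
  have -> : (1 + 5 * dl + (4 * dl)^-1) * eps = eps + 5 * dl * eps + (4 * dl)^-1 * eps.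
    by move: ((4 * dl)^-1) => q; ring.
  apply: lerD; first apply: lerD => //.
  + by apply: ler_wpM2l; [rewrite mulr_ge0 // ltW|exact: EG].
  + by apply: ler_wpM2l => //; rewrite invr_ge0 mulr_ge0 // ltW.
- apply/ler_addgt0Pl => e e0.
  (* sum of the constants in front of eps in the estimates of S^2 and V below *)
  pose k := 2 * dl + 16 * dl ^+ 2 + 2 + (1 + m * h) : R.
  have k0 : 0 < k.
    have : 0 < dl ^+ 2 by rewrite exprn_gt0.
    have : 0 <= m * h by rewrite mulr_ge0.
    rewrite /k; move: dl0; move: (m * h) (dl ^+ 2); clear => *; lra.
  pose eps := Num.min 1 (e / k).
  have eps0 : 0 < eps by rewrite lt_min ltr01 divr_gt0.
  have eps1 : eps <= 1 by rewrite ge_min lexx.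
  have epsk : eps * k <= e by rewrite -ler_pdivlMr // ge_min lexx orbT.
  have [S [V [Q [G [[iS ES] [iS2 [iV EV]] [iQ EQ] [mG PG] [SVQ SW]]]]]] :=
    approx eps eps0.
  pose bS w := (W w ^+ 2 + (2 * dl + 1) * eps) + 16 * dl ^+ 2 * \1_(~` G) w + Q w.
  have i1 := iD _ _ iW2 (icst ((2 * dl + 1) * eps)).
  have i2 := iD _ _ i1 (iZ (16 * dl ^+ 2) _ (iG _ mG)).
  have ibS : P.-integrable [set: Omega] (EFin \o bS) := iD _ _ i2 iQ.
  have ES2 : \int[P]_w (S w ^+ 2) <= \int[P]_w bS w.
    apply: le_Rintegral => // w _; have [V0 Q0 SQ] := SVQ w; rewrite /bS.
    have [Gw|nGw] := pselect (G w).
      have [+ _] := SW w Gw; rewrite indicE memNset; last by apply.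
      rewrite mulr0 addr0 => /ler_normlP[s1 s2]; have /ler_normlP[w1 w2] := W_le w.
      move: s1 s2 w1 w2 Q0 eps0 eps1 dl0; move: (S w) (W w) (Q w) => s x q;
        clear => *; nra.
    rewrite indicE mem_set // mulr1.
    have x0 : 0 <= W w ^+ 2 by exact: sqr_ge0.
    have y0 : 0 <= (2 * dl + 1) * eps
      by rewrite mulr_ge0 ?addr_ge0 ?mulr_ge0 ?(ltW dl0) ?(ltW eps0).
    have z0 : 0 <= 16 * dl ^+ 2 by rewrite mulr_ge0 ?sqr_ge0.
    case: SQ => SQ; last by move: SQ x0 y0 z0; lra.
    have : S w ^+ 2 <= (4 * dl) ^+ 2.
      by rewrite -[S w ^+ 2]real_normK ?num_real // lerXn2r ?nnegrE ?mulr_ge0 ?(ltW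
        dl0).
    by rewrite exprMn; move: Q0 x0 y0 z0; lra.
  pose bV w := m / 2 * tau w + - eps + - (m / 2 * h) * \1_(~` G) w.
  have j1 := iD _ _ (iZ (m / 2) _ itau) (icst (- eps)).
  have ibV : P.-integrable [set: Omega] (EFin \o bV) :=
    iD _ _ j1 (iZ (- (m / 2 * h)) _ (iG _ mG)).
  have EV2 : \int[P]_w bV w <= \int[P]_w V w.
    apply: le_Rintegral => // w _; have [V0 Q0 _] := SVQ w; rewrite /bV.
    have [Gw|nGw] := pselect (G w).
      have [_] := SW w Gw; rewrite indicE memNset; last by apply.
      by rewrite mulr0 addr0.
    rewrite indicE mem_set // mulr1.
    have : m / 2 * tau w <= m / 2 * h.
      by rewrite ler_wpM2l ?divr_ge0 //; have /andP[] := tau_itv w.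
    by move: V0 eps0; lra.
  move: ES2 EV2; rewrite /bS /bV.
  rewrite (ED _ _ i2 iQ) (ED _ _ i1 (iZ (16 * dl ^+ 2) _ (iG _ mG))) (EZ _ _ (iG _ mG)).
  rewrite (ED _ _ iW2 (icst ((2 * dl + 1) * eps))) Ecst.
  rewrite (ED _ _ j1 (iZ (- (m / 2 * h)) _ (iG _ mG))) (EZ _ _ (iG _ mG)).
  rewrite (ED _ _ (iZ (m / 2) _ itau) (icst (- eps))) Ecst (EZ _ _ itau).
  have g1 := EG _ _ mG PG.
  have g0 : 0 <= \int[P]_w (\1_(~` G) w : R) by apply: Rintegral_ge0 => w _;
    rewrite indicE.
  have mh : 0 <= m * h by rewrite mulr_ge0.
  have d2 : 0 <= dl ^+ 2 by exact: sqr_ge0.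
  move: g0 g1 EQ EV epsk; rewrite /k.
  move: (\int[P]_w (\1_(~` G) w : R)) (\int[P]_w Q w) (\int[P]_w V w) (\int[P]_w (S w
    ^+ 2))
    (\int[P]_w (W w ^+ 2)) (\int[P]_w tau w) =>
      x1 x2 x3 x4 x5 x6 g0 g1 EQ EV epsk ES2 EV2.
  have a1 : 16 * dl ^+ 2 * x1 <= 16 * dl ^+ 2 * eps by rewrite ler_wpM2l // mulr_ge0.
  have a2 : m / 2 * h * x1 <= m / 2 * h * eps
    by rewrite ler_wpM2l // mulr_ge0 // divr_ge0.
  move: a1 a2 EQ EV epsk ES2 EV2 eps0 mh d2; clear.
  move: (dl ^+ 2) => d2 *; nra.
Qed.

End limit_moments.

Section exit_moments.
Context d (Omega : measurableType d) (R : realType) (P : probability Omega R).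
Hypothesis P_complete : measure_is_complete P.
Variable B : R -> Omega -> R.
Hypothesis BM : brownian_motion P B.
Notation F := (augmented_filtration P B).

Variables (I : set R) (sigma : R -> R) (x0 : R) (Y : R -> Omega -> R).
Hypothesis I_open : open I.
Hypothesis sigma_cont : {within I, continuous sigma}.
Hypothesis sol : sde_solution P I sigma B x0 Y.
Variables (dl h m : R).
Hypothesis dl_gt0 : 0 < dl.
Hypothesis h_ge0 : 0 <= h.
Hypothesis sigma_ge : forall y, `|y - x0| <= 2 * dl -> m <= sigma y ^+ 2.
Hypothesis m_ge0 : 0 <= m.

Notation disp := (displacement x0 Y).
Notation tau := (exit_time sol dl h_ge0).

(** On the null set where Y does not start near x0 the value 0 keeps the
    displacement below dl. *)
Definition exit_displacement (w : Omega) : R :=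
  if `|disp 0 w| < dl then disp (tau w) w else 0.

Lemma exit_displacement_measurable : measurable_fun [set: Omega] exit_displacement.
Proof.
apply: measurable_fun_ifT => //.
- apply: measurable_fun_ltr => //; apply: measurableT_comp => //.
  by apply: (information_sub P_complete BM (t := 0));
    exact: (displacement_measurable sol (lexx 0) (lexx 0)).
- have := displacement_after_exit_measurable P_complete BM sol dl h_ge0 (lexx 0).
  by under eq_fun do rewrite addr0.
Qed.

Lemma exit_displacement_le w : `|exit_displacement w| <= dl.
Proof.
rewrite /exit_displacement; case: ifP => [st|_]; last by rewrite normr0 ltW.
have tt : 0 <= tau w <= tau w by rewrite exit_time_ge0 lexx.
exact: displacement_before_exit st tt.
Qed.

Definition oscillating (e mesh : R) : set Omega :=
  [set w | exists2 u, 0 <= u <= mesh &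
    e < `|disp (tau w + u) w - disp (tau w) w|].

(** The paths are continuous, so these events decrease to the empty set. *)
Lemma oscillation_small (e eps : R) : 0 < e -> 0 < eps ->
  \forall k \near \oo,
    measurable (oscillating e k.+1%:R^-1) /\
    (P (oscillating e (k.+1%:R^-1)%R) < eps%:E)%E.
Proof.
move=> e0 eps0.
pose f (u : R) (w : Omega) : R := `|disp (tau w + u) w - disp (tau w) w|.
have cf w : continuous (f ^~ w).
  move=> u; apply: cvg_norm; apply: cvgB; last exact: cvg_cst.
  have cadd : {for u, continuous (fun u : R => tau w + u)}.
    by apply: cvgD; [exact: cvg_cst|exact: cvg_id].
  have cd : continuous (disp ^~ w) by move=> s; exact: (displacement_continuous sol).
  exact: (continuous_comp cadd (cd _)).
have mf u : 0 <= u -> measurable_fun [set: Omega] (f u).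
  move=> u0; apply: measurableT_comp => //; apply: measurable_funB.
    exact: (displacement_after_exit_measurable P_complete BM sol dl h_ge0 u0).
  have := displacement_after_exit_measurable P_complete BM sol dl h_ge0 (lexx 0).
  by under eq_fun do rewrite addr0.
pose E (k : nat) := [set w | exists2 u, 0 <= u <= k.+1%:R^-1 & e < f u w].
have mE k : measurable (E k).
  by apply: measurable_exists_gt => // u /andP[u0 _]; exact: mf.
have E0 : \bigcap_k E k = set0.
  rewrite -subset0 => w HE.
  have : \forall u \near (0:R), f u w < e.
    by apply: (cvgr_lt _ (cf w 0)); rewrite /f addr0 subrr normr0.
  case=> r /= r0 Hr; have [k rk] := ltr_add_invr r0.
  have [u /andP[u0 uk] eu] := HE k Logic.I.
  have := Hr u; rewrite /ball_ /= sub0r normrN ger0_norm //.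
  move=> /(_ (le_lt_trans uk _)); rewrite add0r in rk => /(_ rk).
  by rewrite ltNge (ltW eu).
have : P (E k) @[k --> \oo] --> 0%E.
  rewrite -(measure0 P) -E0; apply: nonincreasing_cvg_mu => //.
  - by rewrite -ge0_fin_numE // fin_num_measure.
  - exact: bigcapT_measurable.
  - move=> i j ij; apply/subsetPset => w [u /andP[u0 uj] eu]; exists u => //.
    by rewrite u0 (le_trans uj) // lef_pV2 ?posrE // ler_nat ltnS.
move=> PE; have H : \forall k \near \oo, (P (E k) < eps%:E)%E.
  by apply: (cvge_ltr _ PE); rewrite lte_fin.
by near=> k; split; [exact: mE|near: k; exact: H].
Unshelve. all: end_near. Qed.

(** Choose the simple process first, then the mesh of the grid: the bound on the
    overshoot involves the bound K of the simple process. *)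
Lemma exit_moments :
  \int[P]_w exit_displacement w = 0 /\
  m / 16 * \int[P]_w tau w <= \int[P]_w (exit_displacement w ^+ 2).
Proof.
apply: (@approximable_moments _ _ _ _ _ _ dl h) => //.
- exact: exit_displacement_measurable.
- exact: exit_displacement_le.
- exact: (exit_time_measurable P_complete BM).
- by move=> w; rewrite exit_time_ge0 exit_time_le.
move=> eps eps0.
(* e < dl keeps the sum from being frozen before tau; 2 e <= eps absorbs the two
   errors, of the approximation and of the rounding of tau to the grid *)
pose e := Num.min (eps / 2) (dl / 2).
have e0 : 0 < e by rewrite lt_min !divr_gt0.
have e_dl : e < dl by rewrite gt_min; apply/orP; right;
  rewrite ltr_pdivrMr // ltr_pMr // ltr1n.
have e_eps : 2 * e <= eps.
  have : e <= eps / 2 by rewrite ge_min lexx.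
  lra.
have eps3 : 0 < eps / 3 by rewrite divr_gt0.
have [Hn [Hs Hcvg]] := sol_equation sol.
have [L2 sup] := Hcvg h e h_ge0 e0.
have /filter_ex[n [/= L2n supn]] : \forall n \near \oo,
    (P [set w | (e%:E < \int[lebesgue_measure]_(s in `[0%R, h])
                      ((sp_value (Hn n) s w - sigma (Y s w)) ^+ 2)%:E)%E] < (eps /
                        3)%:E)%E /\
    (P [set w | exists2 s, (0 <= s <= h)%R &
                    (e < `|sp_integral B (Hn n) s w - (Y s w - x0)|)%R] < (eps /
                      3)%:E)%E.
  apply: filterI.
  - by apply: (cvge_ltr _ L2); rewrite lte_fin.
  - by apply: (cvge_ltr _ sup); rewrite lte_fin.
move: (Hn n) (Hs n) L2n supn => H sH L2H supH {Hn Hs Hcvg L2 sup}.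
set bad2 := [set w | _] in L2H; set bad1 := [set w | _] in supH.
have [K HK] := sp_value_bounded sH.
have K0 : 0 <= K by apply: le_trans (HK 0 point).
pose C := 4 * K ^+ 4 / (2 * dl) ^+ 2.
have C0 : 0 <= C by rewrite divr_ge0 ?mulr_ge0 ?exprn_ge0 ?mulr_ge0 // ltW.
have [k [[mbad3 Pbad3] Ck]] : exists k,
    (measurable (oscillating e k.+1%:R^-1) /\
     (P (oscillating e (k.+1%:R^-1)%R) < (eps / 3)%:E)%E) /\
    C * (128 * k.+1%:R^-1 * h) <= eps.
  have : \forall k \near \oo, C * 128 * h / eps < k%:R.
    exact: nbhs_infty_gtr.
  move=> big; have := oscillation_small e0 eps3 => osc.
  have /filter_ex[k [k1 k2]] : \forall k \near \oo,
      (measurable (oscillating e k.+1%:R^-1) /\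
       (P (oscillating e (k.+1%:R^-1)%R) < (eps / 3)%:E)%E) /\ C * 128 * h / eps < k%:R.
    by apply: filterI.
  exists k; split => //.
  have kk : C * 128 * h / eps < k.+1%:R by apply: lt_trans k2 _; rewrite ltr_nat.
  move: kk; rewrite ltr_pdivrMr // => kk.
  have -> : C * (128 * k.+1%:R^-1 * h) = C * 128 * h / k.+1%:R by ring.
  by rewrite ler_pdivrMr // (mulrC eps) ltW.
set bad3 := oscillating _ _ in mbad3 Pbad3.
pose mesh : R := k.+1%:R^-1.
have mesh0 : 0 < mesh by rewrite invr_gt0.
have time_ge0 j : 0 <= sp_time H j.
  by have [t0 tm _] := sH; apply: le_trans t0 (tm _ _ (leq0n j)).
have [c [N [c0 cN c_mono c_mesh c_off]]] := exists_fine_grid h_ge0 mesh0 time_ge0.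
have c_homo j : c j <= c j.+1 by have [] := c_mono j.
have c_le j : c j <= h by have [] := c_mono j.
have c0' : 0 <= c 0%N by rewrite c0.
have c_ge0 j : 0 <= c j by elim: j => // j /le_trans; apply.
have xi_m := grid_coef_measurable sH c_off.
have xi_le j w : `|grid_coef H c j w| <= K.
  by rewrite /grid_coef; case: ifP => // _; rewrite normr0.
have tau_st j : F (c j) [set w | tau w <= c j].
  by have [_] := exit_time_stopping sol dl h_ge0; apply.
have a0 : 0 < 2 * dl by rewrite mulr_gt0.
pose bad0 := [set w | dl <= `|disp 0 w|].
have mdisp0 : measurable_fun [set: Omega] (fun w => `|disp 0 w|).
  apply: measurableT_comp => //; apply: (information_sub P_complete BM (t := 0)).
  exact: (displacement_measurable sol (lexx 0) (lexx 0)).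
have mbad0 : measurable bad0.
  have := mdisp0 measurableT _ (measurable_itv `[dl, +oo[).
  by rewrite setTI preimage_itvcy.
have Pbad0 : P bad0 = 0.
  apply/negligibleP => //; apply: negligibleS (displacement0_ae sol) => w /= db.
  by move=> z; move: db; rewrite /bad0 /= z normr0 leNgt dl_gt0.
have mbad1 : measurable bad1
  by exact: (sup_error_measurable P_complete BM sol sH h_ge0).
have mbad2 : measurable bad2.
  exact: (l2_error_measurable P_complete BM I_open sigma_cont sol h sH).
pose G := ~` (bad0 `|` bad1 `|` bad2 `|` bad3).
have [iD ED] := increments_fourth_moment P_complete BM c0' c_homo N c_mesh.
exists (stopped_sum B c (grid_coef H c) tau (2 * dl) N),
  (stopped_bracket B c (grid_coef H c) tau (2 * dl) N),
  (fun w => C * \sum_(j < N) (B (c j.+1) w - B (c j) w) ^+ 4), G.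
split.
- exact: (stopped_sum_mean P_complete BM (2 * dl) c0' c_homo xi_m xi_le tau_st).
- have [i2 E2] := stopped_sum_second_moment P_complete BM c0' c_homo xi_m xi_le
  tau_st a0 N.
  split => //; split => //.
  exact: (stopped_bracket_integrable P_complete BM (2 * dl) c0' c_homo xi_m xi_le
    tau_st N).
- split; first exact: (integrableZl measurableT C iD).
  rewrite RintegralZl //; apply: le_trans Ck; rewrite ler_wpM2l //.
  by move: ED; rewrite cN c0 subr0.
- split; first by apply: measurableC; do !apply: measurableU.
  rewrite setCK; apply: le_trans (measureU2 _ _ _) _ => //;
    first by do !apply: measurableU.
  have -> : eps = 0 + eps / 3 + eps / 3 + eps / 3 by lra.
  rewrite !EFinD; apply: leeD; last exact: ltW.
  apply: le_trans (measureU2 _ _ _) _ => //; first by do !apply: measurableU.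
  apply: leeD; last exact: ltW.
  apply: le_trans (measureU2 _ _ _) _ => //.
  apply: leeD; last exact: ltW.
  by rewrite [X in (X <= _)%E]Pbad0.
- split=> w.
    split.
    + by apply: sumr_ge0 => j _; rewrite mulr_ge0 ?sqr_ge0 // subr_ge0.
    + by rewrite mulr_ge0 //; apply: sumr_ge0 => j _; rewrite exprn_even_ge0.
    + have -> : 4 * dl = 2 * (2 * dl) by ring.
      exact: (stopped_sum_overshoot B c tau xi_le a0 N w).
  move=> Gw.
  have start : `|disp 0 w| < dl.
    by rewrite ltNge; apply/negP => ?; apply: Gw; left; left; left.
  have sup_w s : 0 <= s <= h -> `|sp_integral B H s w - disp s w| <= e.
    move=> sh; rewrite leNgt; apply/negP => es; apply: Gw; left; left; right.
    by exists s => //; have /andP[s0 _] := sh; move: es; rewrite displacementE.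
  have l2_w : (\int[lebesgue_measure]_(s in `[0%R, h])
      ((sp_value H s w - sigma (Y s w)) ^+ 2)%:E <= e%:E)%E.
    by rewrite leNgt; apply/negP => es; apply: Gw; left; right.
  have osc_w u : 0 <= u <= mesh -> `|disp (tau w + u) w - disp (tau w) w| <= e.
    move=> um; rewrite leNgt; apply/negP => es; apply: Gw; right.
    by exists u.
  have vol_m : measurable_fun [set: R] (fun s => sigma (Y (Num.max s 0) w)).
    have mp : measurable_fun [set: R] (fun s : R => (s,
      w)) by exact: measurable_fun_pair.
    exact: (measurableT_comp (sigma_path_measurable P_complete BM I_open sigma_cont
      sol) mp).
  have [a1 a2] := stopped_sum_approx sigma_ge m_ge0 sH c0 cN c_homo c_le c_mesh c_off
    (ltW mesh0) e_dl (ltW e0) vol_m start sup_w l2_w osc_w.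
  rewrite /exit_displacement start; split; first exact: le_trans a1 e_eps.
  by apply: le_trans a2; rewrite lerB //; move: e_eps e0; lra.
Qed.

End exit_moments.

(** * Stopping at the exit time *)

(** The integral of a nonnegative function is a supremum over the simple functions
    below it, which grows with the function, be it measurable or not. *)
Lemma integral_mono d (T : measurableType d) (R : realType)
    (mu : {measure set T -> \bar R}) (D : set T) (f g : T -> \bar R) :
  (forall x, D x -> (f x <= g x)%E) ->
  (\int[mu]_(x in D) f x <= \int[mu]_(x in D) g x)%E.
Proof.
move=> fg; rewrite /integral.
have rfg x : ((f \_ D) x <= (g \_ D) x)%E.
  by rewrite !patchE; case: ifPn => // /set_mem /fg.
apply: leeB; apply: le_ereal_sup => _ [h hle <-]; exists h => //= x;
  apply: le_trans (hle x) _.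
- rewrite !funeposE ge_max le_max rfg /= le_max lexx orbT //.
- rewrite !funenegE ge_max le_max leeN2 rfg /= le_max lexx orbT //.
Qed.

(** Replace g by its minimum with f, which differs from f on a null set only and
    hence is measurable for a complete measure. *)
Lemma ae_integral_mono d (T : measurableType d) (R : realType)
    (mu : {measure set T -> \bar R}) (f g : T -> \bar R) :
  measure_is_complete mu -> measurable_fun [set: T] f ->
  {ae mu, forall x, (f x <= g x)%E} ->
  (\int[mu]_x f x <= \int[mu]_x g x)%E.
Proof.
move=> cmu mf fg; pose f' x := mine (f x) (g x).
have ff' : ae_eq mu setT f f'.
  by apply: filterS fg => x fgx _; rewrite /f' min_l.
have mf' : measurable_fun [set: T] f' by exact: ae_measurable_fun ff' mf.
have -> : (\int[mu]_x f x = \int[mu]_x f' x)%E by exact: ae_eq_integral.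
by apply: integral_mono => x _; rewrite ge_min lexx orbT.
Qed.

Lemma open_interval_open (R : realType) (xl xr : \bar R) : open (open_interval xl xr).
Proof.
have -> : open_interval xl xr = EFin @^-1` ([set y | xl < y]%E `&` [set y | y < xr]%E).
  by apply/seteqP; split => x /=; [move=> /andP[]|move=> [a b]; apply/andP].
apply: open_comp; first by move=> x _; apply: cvg_EFin; [exact: nearW|exact: cvg_id].
by apply: openI; [exact: open_ereal_gt_ereal|exact: open_ereal_lt_ereal].
Qed.

Lemma discount_bounds d (Omega : measurableType d) (R : realType) (r : R -> R)
    (Y : R -> Omega -> R) (t K : R) (w : Omega) : 0 <= t ->
  (forall s, 0 <= s <= t -> 0 <= r (Y s w) <= K) ->
  1 - K * t <= discount r Y t w <= 1.
Proof.
move=> t0 rK; set q := \int[lebesgue_measure]_(s in `[0, t]) r (Y s w).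
have q_itv : 0 <= q <= K * t.
  rewrite /q /Rintegral.
  have J0 : (0 <= \int[lebesgue_measure]_(s in `[0%R, t]) (r (Y s w))%:E)%E.
    by apply: integral_ge0 => s /=; rewrite in_itv /= => /rK /andP[]; rewrite lee_fin.
  have JK : (\int[lebesgue_measure]_(s in `[0%R, t]) (r (Y s w))%:E <= (K * t)%:E)%E.
    apply: (@le_trans _ _ (\int[lebesgue_measure]_(s in `[0%R, t]) K%:E)%E).
      by apply: integral_mono => s /=; rewrite in_itv /= => /rK /andP[_];
        rewrite lee_fin.
    have len : lebesgue_measure (`[0, t]%classic : set R) = t%:E.
      rewrite lebesgue_measure_itv /= lte_fin; case: ltP => [_|cK];
        first by rewrite sube0.
      by congr EFin; apply/eqP; rewrite eq_le cK t0.
    by rewrite integral_cst // [X in (_ * X)%E]len EFinM.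
  move: J0 JK; case: (\int[lebesgue_measure]_(s in `[0%R,
    t]) (r (Y s w))%:E)%E => [x| |] //=.
  by rewrite !lee_fin => -> ->.
rewrite /discount -/q; case/andP: q_itv => q0 qK.
rewrite -{2}expR0 ler_expR oppr_le0 q0 andbT.
by apply: le_trans (expR_ge1Dx _); rewrite lerB.
Qed.

Lemma continuous_bounded_near (R : realType) (I : set R) (f : R -> R) (x d : R) :
  0 <= d -> (forall y, `|y - x| <= d -> I y) -> {within I, continuous f} ->
  exists a b, [/\ `|a - x| <= d, `|b - x| <= d &
    forall y, `|y - x| <= d -> f a <= f y <= f b].
Proof.
move=> d0 Id cf.
have xd : x - d <= x + d by lra.
have itv y : (y \in `[x - d, x + d]) = (`|y - x| <= d).
  by rewrite in_itv /= ler_distl.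
have cfd : {within `[x - d, x + d], continuous f}.
  by apply: continuous_subspaceW cf => y /=; rewrite itv; exact: Id.
have [a ad fa] := EVT_min xd cfd; have [b bd fb] := EVT_max xd cfd.
exists a, b; split; rewrite -?itv // => y; rewrite -itv => yd.
by rewrite fa ?fb.
Qed.

Section exit_reward.
Context d (Omega : measurableType d) (R : realType) (P : probability Omega R).
Hypothesis P_complete : measure_is_complete P.
Variable B : R -> Omega -> R.
Hypothesis BM : brownian_motion P B.

Variables (I : set R) (sigma : R -> R) (x0 : R) (Y : R -> Omega -> R).
Hypothesis I_open : open I.
Hypothesis sigma_cont : {within I, continuous sigma}.
Hypothesis sol : sde_solution P I sigma B x0 Y.
Variables (dl h m : R).
Hypothesis dl_gt0 : 0 < dl.
Hypothesis h_gt0 : 0 < h.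
Hypothesis sigma_ge : forall y, `|y - x0| <= 2 * dl -> m <= sigma y ^+ 2.
Hypothesis m_ge0 : 0 <= m.
Variables (r g : R -> R) (rM gM a k : R).
Hypothesis r_itv : forall y, `|y - x0| <= dl -> 0 <= r y <= rM.
Hypothesis g_le : forall y, `|y - x0| <= dl -> `|g y| <= gM.
Hypothesis g_kink : forall y, `|y - x0| <= dl ->
  g x0 + a * (y - x0) + k * `|y - x0| <= g y.
Hypothesis k_ge0 : 0 <= k.
Hypothesis gain : rM * gM < k / dl * (m / 16).

Notation tau := (exit_time sol dl (ltW h_gt0)).
Notation disp := (displacement x0 Y).

(** |W| >= W^2 / dl since |W| <= dl, and the discount factor is at least
    1 - rM tau. *)
Let exit_pathwise w : disp 0 w = 0 ->
  g x0 + a * exit_displacement sol dl (ltW h_gt0) w +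
    k / dl * exit_displacement sol dl (ltW h_gt0) w ^+ 2 - rM * gM * tau w <=
  discount r Y (tau w) w * g (Y (tau w) w).
Proof.
move=> start; rewrite /exit_displacement start normr0 dl_gt0.
have start' : `|disp 0 w| < dl by rewrite start normr0.
have t0 : 0 <= tau w by exact: exit_time_ge0.
have near_x0 s : 0 <= s <= tau w -> `|Y s w - x0| <= dl.
  move=> st; have /andP[s0 _] := st; rewrite -(@displacementE _ _ _ x0 Y) //.
  exact: displacement_before_exit start' st.
have tt : 0 <= tau w <= tau w by rewrite t0 lexx.
have := @discount_bounds _ _ _ r Y (tau w) rM w t0 (fun s st => r_itv (near_x0 s st)).
rewrite displacementE //; have Yt := near_x0 _ tt.
have := g_kink Yt; have := g_le Yt; have rM0 : 0 <= rM.
  by have /andP[] := r_itv Yt; exact: le_trans.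
move: (discount r Y (tau w) w) Yt t0 => D.
move: (tau w) (g (Y (tau w) w)) => t G;
  move: (Y t w - x0) => x xd t0 /ler_normlP[G1 G2] gk /andP[D1 D2].
have sq : k / dl * x ^+ 2 <= k * `|x|.
  rewrite -mulrA ler_wpM2l // mulrC ler_pdivrMr // -[x ^+ 2]real_normK ?num_real //.
  by rewrite expr2 ler_wpM2l.
have : G - rM * gM * t <= D * G.
  have gM0 : 0 <= gM by lra.
  have : (1 - D) * G <= (rM * t) * gM.
    apply: (@le_trans _ _ ((1 - D) * gM)); first by rewrite ler_wpM2l //; lra.
    by rewrite ler_wpM2r //; lra.
  lra.
lra.
Qed.

(** On average the linear term vanishes, and the hypothesis on the constants makes
    the quadratic gain exceed the cost of discounting because E tau > 0. *)
Lemma exit_reward_gt :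
  ((g x0)%:E < 'E_P[fun w => (discount r Y (tau w) w * g (Y (tau w) w))%R])%E.
Proof.
have [EW EW2] := exit_moments P_complete BM I_open sigma_cont sol dl_gt0 (ltW h_gt0)
  sigma_ge m_ge0.
have mW := exit_displacement_measurable P_complete BM sol dl (ltW h_gt0).
have W_le := exit_displacement_le sol dl_gt0 (ltW h_gt0).
have mtau := exit_time_measurable P_complete BM sol dl (ltW h_gt0).
move: EW EW2 mW W_le exit_pathwise.
set W := exit_displacement _ _ _; set t := tau => EW EW2 mW W_le low.
pose psi w := g x0 + a * W w + k / dl * W w ^+ 2 + - (rM * gM) * t w.
have iW : P.-integrable [set: Omega] (EFin \o W) by exact: bounded_integrable mW W_le.
have iW2 : P.-integrable [set: Omega] (EFin \o (fun w => W w ^+ 2)).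
  apply: (@bounded_integrable _ _ _ _ _ (dl ^+ 2)); first exact: measurable_funX.
  by move=> w; rewrite normrX lerXn2r ?nnegrE ?(ltW dl_gt0).
have it : P.-integrable [set: Omega] (EFin \o t).
  apply: (@bounded_integrable _ _ _ _ _ h) => // w.
  by rewrite ger0_norm ?exit_time_ge0 ?exit_time_le.
have i0 : P.-integrable [set: Omega] (EFin \o (fun=> g x0)).
  exact: finite_measure_integrable_cst.
have ia : P.-integrable [set: Omega] (EFin \o (fun w => a * W w)) :=
  integrableZl measurableT a iW.
have ik : P.-integrable [set: Omega] (EFin \o (fun w => k / dl * W w ^+ 2)) :=
  integrableZl measurableT (k / dl) iW2.
have ir : P.-integrable [set: Omega] (EFin \o (fun w => - (rM * gM) * t w)) :=
  integrableZl measurableT (- (rM * gM)) it.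
have i1 : P.-integrable [set: Omega] (EFin \o (fun w => g x0 + a * W w)) :=
  integrableD measurableT i0 ia.
have i2 : P.-integrable [set: Omega] (EFin \o (fun w =>
  g x0 + a * W w + k / dl * W w ^+ 2)) :=
  integrableD measurableT i1 ik.
have ipsi : P.-integrable [set: Omega] (EFin \o psi) := integrableD measurableT i2 ir.
have Epsi : \int[P]_w psi w = g x0 + k / dl * \int[P]_w (W w ^+ 2) - rM * gM *
  \int[P]_w t w.
  have P1 : fine (P [set: Omega]) = 1 by rewrite probability_setT.
  rewrite /psi (RintegralD measurableT i2 ir) (RintegralD measurableT i1 ik).
  rewrite (RintegralD measurableT i0 ia) !RintegralZl // EW mulr0 addr0 mulNr.
  by rewrite Rintegral_cst // [X in _ * X + _ - _]P1 mulr1.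
have Et : 0 < \int[P]_w t w.
  have Et0 : 0 <= \int[P]_w t w by apply: Rintegral_ge0 => w _; exact: exit_time_ge0.
  rewrite lt_neqAle Et0 andbT eq_sym; apply/eqP => Et0'.
  have : (\int[P]_w `|(t w)%:E| = 0)%E.
    rewrite (eq_integral (fun w => (t w)%:E)); last first.
      by move=> w _; rewrite gee0_abs // lee_fin exit_time_ge0.
    by rewrite -[LHS]fineK ?integrable_fin_num // -/(Rintegral _ _ _) Et0'.
  move=> /(ae_eq_integral_abs P measurableT (measurable_int _ it)) t_ae.
  have : {ae P, forall w : Omega, False}.
    apply: filterS2 t_ae (displacement0_ae sol) => w /= /(_ Logic.I) [tw] dw.
    by have := exit_time_gt0 sol (ltW h_gt0) dl_gt0 h_gt0 dw; rewrite -/t tw ltxx.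
  case=> N [mN N0 subN].
  have : P [set: Omega] = 0.
    by apply: subset_measure0 N0 => // w _; apply: subN.
  by rewrite probability_setT => /eqP; rewrite onee_eq0.
rewrite expectation.unlock.
apply: (@lt_le_trans _ _ (\int[P]_w (psi w)%:E)%E).
  rewrite -[X in (_ < X)%E]fineK ?integrable_fin_num //.
  rewrite lte_fin -/(Rintegral _ _ _) Epsi.
  have kdl : 0 <= k / dl by rewrite divr_ge0 // ltW.
  move: EW2 Et gain; move: (\int[P]_w t w) (\int[P]_w (W w ^+ 2)) => x y EW2 x0' gain'.
  have : k / dl * (m / 16 * x) <= k / dl * y by rewrite ler_wpM2l.
  by nra.
apply: ae_integral_mono => //; first exact: (measurable_int P).
apply: filterS (displacement0_ae sol) => w dw.
by rewrite lee_fin /psi mulNr; exact: low.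
Qed.

End exit_reward.

Theorem proposition4p2
  (R : realType) (d : measure_display) (Omega : measurableType d)
  (P : probability Omega R) (P_complete : measure_is_complete P)
  (B : R -> Omega -> R) (B_brownian : brownian_motion P B)
  (xl xr : \bar R) (xl_lt_xr : (xl < xr)%E)
  (sigma : R -> R)
  (sigma_continuous : {within open_interval xl xr, continuous sigma})
  (sigma_gt0 : forall x, open_interval xl xr x -> 0 < sigma x)
  (X : R -> R -> Omega -> R)
  (X_solution : forall x, open_interval xl xr x ->
     unique_strong_solution P (open_interval xl xr) sigma B x (X x))
  (X_feller : feller_process P (open_interval xl xr)
     (augmented_filtration P B) X)
  (X_natural : natural_boundaries P (open_interval xl xr) X)
  (T : R) (T_gt0 : 0 < T)
  (r : R -> R) (r_continuous : {within open_interval xl xr, continuous r})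
  (r_ge0 : forall x, open_interval xl xr x -> 0 <= r x)
  (g : R -> R) (g_continuous : {within open_interval xl xr, continuous g})
  (g_dc : difference_of_convex (open_interval xl xr) g)
  (g_integrable : integrable_reward P (open_interval xl xr) T r g X)
  (ddg : set R -> R)
  (ddgE : second_derivative_measure (open_interval xl xr) g ddg)
  (mu_pos mu_neg : {measure set (measurableTypeR R) -> \bar R})
  (mu_jordan : jordan_decomposition_on (open_interval xl xr)
     (mu_measure sigma r g ddg) mu_pos mu_neg)
  (mu_finite : forall x, open_interval xl xr x ->
     (expected_local_time P (open_interval xl xr) T sigma r (X x) mu_pos
        < +oo)%E \/
     (expected_local_time P (open_interval xl xr) T sigma r (X x) mu_neg
        < +oo)%E)
  (x0 : R) (x0_in : open_interval xl xr x0)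
  (mu_x0 : 0 < mu_measure sigma r g ddg [set x0]) :
  `[0, T[%classic `*` [set x0] `<=`
    continuation_set P (open_interval xl xr) (augmented_filtration P B)
      T r g X.
Proof.
move=> [t x] [/= + ->]; rewrite in_itv /= => /andP[t_ge0 tT].
split => //=; first by rewrite t_ge0 ltW.
have I_open : open (open_interval xl xr) by exact: open_interval_open.
have [sol _] := X_solution _ x0_in.
have ddg_x0 : 0 < ddg [set x0].
  by move: mu_x0; rewrite /mu_measure Rintegral_set1 subr0.
have [d0 d0_gt0 Id0] : exists2 d0, 0 < d0 & forall y,
  `|y - x0| <= d0 -> open_interval xl xr y.
  have [e /= e0 He] := (open_nbhs_nbhs (conj I_open x0_in) : nbhs x0 (open_interval
    xl xr)).
  exists (e / 2); first by rewrite divr_gt0.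
  move=> y ye; apply: He; rewrite /ball_ /= distrC; apply: le_lt_trans ye _.
  by rewrite ltr_pdivrMr // ltr_pMr // ltr1n.
have [a [k [dk [k_gt0 /andP[dk_gt0 dk_le] kink]]]] :=
  kink_lower_bound d0_gt0 Id0 g_continuous g_dc ddgE ddg_x0.
have Idk y : `|y - x0| <= dk -> open_interval xl xr y by move=> /le_trans/(_ dk_le);
  exact: Id0.
have [a1 [b1 [a1d _ sigma_le]]] :=
  continuous_bounded_near (ltW dk_gt0) Idk sigma_continuous.
have [a2 [b2 [_ _ r_le]]] := continuous_bounded_near (ltW dk_gt0) Idk r_continuous.
have [a3 [b3 [_ _ g_le]]] := continuous_bounded_near (ltW dk_gt0) Idk g_continuous.
pose m := sigma a1 ^+ 2.
have m_gt0 : 0 < m by rewrite exprn_gt0 // sigma_gt0 //; exact: Idk.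
pose gM := Num.max `|g a3| `|g b3|.
pose rM := r b2.
pose C := `|rM * gM| + 1.
have C_gt0 : 0 < C by rewrite ltr_wpDl.
(* the first bound keeps ]x0 - 2 dl, x0 + 2 dl[ in the range where the bounds
   hold, the second makes the factor 1 / dl of the gain win *)
pose dl := Num.min (dk / 2) (k * m / (16 * C)).
have dl_gt0 : 0 < dl.
  by rewrite lt_min; apply/andP; split; apply: divr_gt0 => //; rewrite mulr_gt0.
have dl_dk : 2 * dl <= dk.
  by rewrite mulrC -ler_pdivlMr // ge_min lexx.
have dl_dk' : dl <= dk by move: dl_dk dl_gt0; lra.
have h_gt0 : 0 < T - t by rewrite subr_gt0.
have gain : rM * gM < k / dl * (m / 16).
  have : dl <= k * m / (16 * C) by rewrite ge_min lexx orbT.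
  rewrite ler_pdivlMr ?mulr_gt0 // => dlC.
  have -> : k / dl * (m / 16) = k * m / 16 / dl by ring.
  rewrite ltr_pdivlMr //.
  have : rM * gM < C by rewrite /C; apply: le_lt_trans (ler_norm _) _; rewrite ltrDl.
  by move=> rg; nra.
have sigma_ge y : `|y - x0| <= 2 * dl -> m <= sigma y ^+ 2.
  move=> yd; have yk := le_trans yd dl_dk.
  have /andP[s1 _] := sigma_le y yk.
  by rewrite lerXn2r // nnegrE ltW // sigma_gt0 //; exact: Idk.
have r_itv y : `|y - x0| <= dl -> 0 <= r y <= rM.
  move=> yd; have yk := le_trans yd dl_dk'.
  by have /andP[_ ->] := r_le y yk; rewrite r_ge0 //; exact: Idk.
have g_bnd y : `|y - x0| <= dl -> `|g y| <= gM.
  move=> yd; have /andP[g1 g2] := g_le y (le_trans yd dl_dk').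
  rewrite ler_norml /gM; apply/andP; split.
    rewrite lerNl; apply: le_trans (_ : `|g a3| <= _); last by rewrite le_max lexx.
    by apply: (@le_trans _ _ (- g a3)); [rewrite lerN2|rewrite -normrN ler_norm].
  apply: le_trans g2 _; apply: le_trans (ler_norm _) _.
  by rewrite le_max lexx orbT.
have kink' y : `|y - x0| <= dl -> g x0 + a * (y - x0) + k * `|y - x0| <= g y.
  by move=> yd; apply: kink; exact: le_trans yd dl_dk'.
apply: lt_le_trans (exit_reward_gt P_complete B_brownian I_open sigma_continuous sol
  dl_gt0 h_gt0 sigma_ge (ltW m_gt0) r_itv g_bnd kink' (ltW k_gt0) gain) _.
apply: ereal_sup_ubound; exists (exit_time sol dl (ltW h_gt0)) => //.
by split; [exact: exit_time_stopping|move=> w; exact: exit_time_le].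
Qed.
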